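(* Let $\gamma_1,\gamma_2,\gamma_3,\delta_1,\delta_2,\delta_3,x,y\in\mathbb{C}$, let $\alpha_1,\dots,\alpha_4,\beta_1,\dots,\beta_4$ be positive real numbers, and let $\sigma_1,\sigma_2\in\mathbb{C}$ with $\operatorname{Re}\sigma_1>0$ and $\operatorname{Re}\sigma_2>0$. Then $$\int_0^1\!\!\int_0^1\xi^{\delta_2-1}\eta^{\delta_3-1}(1-\xi)^{\sigma_1-1}(1-\eta)^{\sigma_2-1}D_1\left(\begin{matrix}\gamma_1,\alpha_1,\beta_1;\gamma_2,\alpha_2;\gamma_3,\beta_2;\\ \delta_1,\alpha_3,\beta_3;\delta_2,\alpha_4;\delta_3,\beta_4;\end{matrix}\left|\begin{matrix}x\xi^{\alpha_4}\\ y\eta^{\beta_4}\end{matrix}\right.\right)d\xi\,d\eta$$ $$=\Gamma(\sigma_1)\Gamma(\sigma_2)\,D_1\left(\begin{matrix}\gamma_1,\alpha_1,\beta_1;\gamma_2,\alpha_2;\gamma_3,\beta_2;\\ \delta_1,\alpha_3,\beta_3;\delta_2+\sigma_1,\alpha_4;\delta_3+\sigma_2,\beta_4;\end{matrix}\left|\begin{matrix}x\\ y\end{matrix}\right.\right).$$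
   Context: $(\gamma)_\lambda=\Gamma(\gamma+\lambda)/\Gamma(\gamma)$ for $\gamma\in\mathbb{C}$ and real $\lambda\ge0$. For complex $\gamma_i,\delta_i,x,y$ and positive real $\alpha_i,\beta_i$, $$D_1\left(\begin{matrix}\gamma_1,\alpha_1,\beta_1;\gamma_2,\alpha_2;\gamma_3,\beta_2;\\ \delta_1,\alpha_3,\beta_3;\delta_2,\alpha_4;\delta_3,\beta_4;\end{matrix}\left|\begin{matrix}x\\ y\end{matrix}\right.\right)=\sum_{m,n=0}^{\infty}\frac{(\gamma_1)_{\alpha_1 m+\beta_1 n}(\gamma_2)_{\alpha_2 m}(\gamma_3)_{\beta_2 n}}{\Gamma(\delta_1+\alpha_3 m+\beta_3 n)}\frac{x^m}{\Gamma(\delta_2+\alpha_4 m)}\frac{y^n}{\Gamma(\delta_3+\beta_4 n)}.$$ The functions are considered at arguments in the region of absolute convergence of their defining series.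
   Formalization: The conditions Re δ₂ > 0 and Re δ₃ > 0 are added; without them the integral generally diverges or the identity fails (e.g. δ₂ = 0, x = y = 0, δ₁ = δ₃ = σ₁ = σ₂ = 1 gives 0 = 1). *)

(* Defs.v *)
From mathcomp Require Import all_boot all_order all_algebra.
From mathcomp Require Import all_classical all_reals all_analysis.
From mathcomp Require Import complex.
Set Implicit Arguments.
Unset Strict Implicit.
Unset Printing Implicit Defensive.
Import Order.TTheory GRing.Theory Num.Theory.
Import numFieldNormedType.Exports.
Local Open Scope classical_set_scope.
Local Open Scope ring_scope.
Local Open Scope complex_scope.

(* Principal value of t ^ z for a positive real base t and complex z; it is
   only meant for t > 0. *)
Definition cpowR {R : realType} (t : R) (z : R[i]) : R[i] :=
  (t `^ (complex.Re z) * cos (complex.Im z * ln t))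
  +i* (t `^ (complex.Re z) * sin (complex.Im z * ln t)).

(* Lebesgue integral of complex-valued functions, coordinatewise. *)
Definition cintegrable d (T : measurableType d) (R : realType)
    (mu : {measure set T -> \bar R}) (D : set T) (f : T -> R[i]) : Prop :=
  mu.-integrable D (fun t => (complex.Re (f t))%:E) /\
  mu.-integrable D (fun t => (complex.Im (f t))%:E).

Definition cintegral d (T : measurableType d) (R : realType)
    (mu : {measure set T -> \bar R}) (D : set T) (f : T -> R[i]) : R[i] :=
  (\int[mu]_(t in D) complex.Re (f t)) +i* (\int[mu]_(t in D) complex.Im (f t)).

(* Euler's integral of the second kind, meaningful for 0 < Re z. *)
Definition Gamma_integral {R : realType} (z : R[i]) : R[i] :=
  cintegral (@lebesgue_measure R) `]0, +oo[
    (fun t => cpowR t (z - 1) * (expR (- t))%:C).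

(* Continuation to Re z <= 0 by the functional equation:
   Gamma z = Gamma (z + n) / (z (z + 1) ... (z + n - 1)), with n the least
   natural number such that 0 < Re z + n (so n = 0 when 0 < Re z).  At the poles
   z = 0, -1, -2, ... the product vanishes, so Gamma z = 0 there, and hence
   (Gamma z)^-1 = 0: this is the value of the entire function 1 / Gamma. *)
Definition Gamma {R : realType} (z : R[i]) : R[i] :=
  let n := Num.truncn (1 - complex.Re z) in
  Gamma_integral (z + n%:R) / \prod_(i < n) (z + i%:R).

(* (g)_l = Gamma (g + l) / Gamma g for real l >= 0.  When g is a pole of Gamma
   the quotient is read as its limit in g: the rising factorial if l is a natural
   number, and 0 otherwise. *)
Definition poch {R : realType} (g : R[i]) (l : R) : R[i] :=
  if `[< exists k : nat, g = - k%:R >] then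
    if l \is a Num.nat then \prod_(i < Num.truncn l) (g + i%:R) else 0
  else Gamma (g + l%:C) / Gamma g.

Definition D1_term {R : realType}
    (g1 : R[i]) (a1 b1 : R) (g2 : R[i]) (a2 : R) (g3 : R[i]) (b2 : R)
    (d1 : R[i]) (a3 b3 : R) (d2 : R[i]) (a4 : R) (d3 : R[i]) (b4 : R)
    (x y : R[i]) (m n : nat) : R[i] :=
  poch g1 (a1 * m%:R + b1 * n%:R) * poch g2 (a2 * m%:R) * poch g3 (b2 * n%:R)
    / Gamma (d1 + (a3 * m%:R + b3 * n%:R)%:C)
  * (x ^+ m / Gamma (d2 + (a4 * m%:R)%:C))
  * (y ^+ n / Gamma (d3 + (b4 * n%:R)%:C)).

(* Absolute convergence of a complex double series (unordered sum over
   nat * nat of the moduli is finite). *)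
Definition dseries_abs_cvg {R : realType} (u : nat -> nat -> R[i]) : Prop :=
  summable [set: nat * nat] (fun p => (Normc.normc (u p.1 p.2))%:E).

(* Sum of a complex double series, as the coordinatewise limit of its square
   partial sums; under absolute convergence every order of summation gives the
   same value. *)
Definition dseries {R : realType} (u : nat -> nat -> R[i]) : R[i] :=
  limn (fun N : nat => \sum_(m < N) \sum_(n < N) complex.Re (u m n) : R)
  +i* limn (fun N : nat => \sum_(m < N) \sum_(n < N) complex.Im (u m n) : R).

Definition D1_abs_cvg {R : realType}
    (g1 : R[i]) (a1 b1 : R) (g2 : R[i]) (a2 : R) (g3 : R[i]) (b2 : R)
    (d1 : R[i]) (a3 b3 : R) (d2 : R[i]) (a4 : R) (d3 : R[i]) (b4 : R)
    (x y : R[i]) : Prop :=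
  dseries_abs_cvg (D1_term g1 a1 b1 g2 a2 g3 b2 d1 a3 b3 d2 a4 d3 b4 x y).

Definition D1 {R : realType}
    (g1 : R[i]) (a1 b1 : R) (g2 : R[i]) (a2 : R) (g3 : R[i]) (b2 : R)
    (d1 : R[i]) (a3 b3 : R) (d2 : R[i]) (a4 : R) (d3 : R[i]) (b4 : R)
    (x y : R[i]) : R[i] :=
  dseries (D1_term g1 a1 b1 g2 a2 g3 b2 d1 a3 b3 d2 a4 d3 b4 x y).

(* Main.v *)
Require Import Defs.
From mathcomp Require Import all_boot all_order all_algebra.
From mathcomp Require Import all_classical all_reals all_analysis.
From mathcomp Require Import measurable_realfun complex.
From mathcomp Require Import ring lra.
Import Order.TTheory GRing.Theory Num.Theory.
Import numFieldNormedType.Exports.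
Set Implicit Arguments.
Unset Strict Implicit.
Unset Printing Implicit Defensive.
Local Open Scope classical_set_scope.
Local Open Scope ring_scope.
Local Open Scope complex_scope.

(** Integrate the double series term by term. The (m, n) term of the integrand is
    a constant times

      xi^(delta_2 + alpha_4 m - 1) (1 - xi)^(sigma_1 - 1)
        * eta^(delta_3 + beta_4 n - 1) (1 - eta)^(sigma_2 - 1),

    a product of two beta kernels, and Euler's formula
    Gamma(w) Gamma(z) = Gamma(w + z) B(w, z) ([Gamma_integral_beta]) replaces the
    factors 1 / Gamma(delta_2 + alpha_4 m) and 1 / Gamma(delta_3 + beta_4 n) by
    Gamma(sigma_1) / Gamma(delta_2 + sigma_1 + alpha_4 m) and
    Gamma(sigma_2) / Gamma(delta_3 + sigma_2 + beta_4 n)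
    ([Gamma_beta_quotient]). This is the right-hand side.

    The exchange of sum and integral is dominated convergence for the square
    partial sums ([cintegral_dseries]), and the point is to find the majorant. The
    modulus of a term integrates to real beta values at the real parts of the
    parameters, whereas the convergence known for the right-hand side involves the
    moduli of Gamma at complex points. Two comparisons link them:
    |Gamma(z)| <= Gamma(Re z), immediate from the integral, and conversely
    Gamma(Re z) <= K |Gamma(z)| uniformly along an arithmetic progression
    z = w + al m ([rGamma_ratio_bounded]). The latter comes from the estimate

      |Gamma(u + iv)| >= (1 - 2 v^2 / (u - 1)) Gamma(u)      (u > 1)

    of [normc_Gamma_integral_ge]: the gamma density of parameter u concentrates
    near u, so that the phase of t^(iv) hardly varies. With the functional equation
    it also yields that Gamma has no zero in the right half-plane
    ([Gamma_integral_neq0]), which is what allows dividing by it. The integrals of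
    the moduli of the terms are thus bounded by a constant times the moduli of the
    terms of the right-hand series ([beta_norm_bound]), whose sum is finite.

    Euler's formula itself is Fubini's theorem for the kernel
    s^(w-1) (p - s)^(z-1) e^(-p) on 0 < s < p: a translation in p produces
    Gamma(w) Gamma(z), and the scaling s = p t produces Gamma(w + z) B(w, z). *)

(** * Complex moduli and integrals of complex-valued functions *)

Section complex_modulus.
Context {R : realType}.
Implicit Types z w : R[i].

Lemma normc_ge0 z : 0 <= Normc.normc z.
Proof. by case: z => a b; exact: sqrtr_ge0. Qed.

Lemma normr_Re_le z : `|complex.Re z| <= Normc.normc z.
Proof. by have := normc_ge_Re z; rewrite lecE => /andP[_]. Qed.

Lemma normr_Im_le z : `|complex.Im z| <= Normc.normc z.
Proof.
case: z => a b /=; rewrite -sqrtr_sqr ler_wsqrtr// lerDr; exact: sqr_ge0.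
Qed.

Lemma normc_le_ReIm z : Normc.normc z <= `|complex.Re z| + `|complex.Im z|.
Proof.
case: z => a b /=; rewrite -[leRHS]ger0_norm ?addr_ge0//.
rewrite -[leRHS]sqrtr_sqr ler_wsqrtr// sqrrD !real_normK ?num_real// lerD2r lerDl.
by rewrite mulrn_wge0// mulr_ge0.
Qed.

Lemma normc_real (a : R) : Normc.normc a%:C = `|a|.
Proof. by rewrite /= expr0n/= addr0 sqrtr_sqr. Qed.

Lemma normc_eq0 z : (Normc.normc z == 0) = (z == 0).
Proof.
apply/eqP/eqP => [/Normc.eq0_normc//|->]; exact: Normc.normc0.
Qed.

Lemma ReM z w : complex.Re (z * w) =
  complex.Re z * complex.Re w - complex.Im z * complex.Im w.
Proof. by case: z w => [a b] [c e]. Qed.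

Lemma ImM z w : complex.Im (z * w) =
  complex.Re z * complex.Im w + complex.Im z * complex.Re w.
Proof. by case: z w => [a b] [c e]. Qed.

Lemma ReD z w : complex.Re (z + w) = complex.Re z + complex.Re w.
Proof. by case: z w => [a b] [c e]. Qed.

Lemma ImD z w : complex.Im (z + w) = complex.Im z + complex.Im w.
Proof. by case: z w => [a b] [c e]. Qed.

Lemma complex_eqP z w :
  complex.Re z = complex.Re w -> complex.Im z = complex.Im w -> z = w.
Proof. by case: z w => [a b] [c e] /= -> ->. Qed.

End complex_modulus.

Section complex_integral.
Context d (T : measurableType d) (R : realType).
Implicit Types f g : T -> R[i].

Definition cmeasurable f :=
  measurable_fun setT (fun x => complex.Re (f x)) /\
  measurable_fun setT (fun x => complex.Im (f x)).

Lemma cmeasurable_cst (c : R[i]) : cmeasurable (fun=> c).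
Proof. by split; exact: measurable_cst. Qed.

Lemma cmeasurable_real (f : T -> R) :
  measurable_fun setT f -> cmeasurable (fun x => (f x)%:C).
Proof. by move=> mf; split => //=; exact: measurable_cst. Qed.

Lemma cmeasurableM f g :
  cmeasurable f -> cmeasurable g -> cmeasurable (fun x => f x * g x).
Proof.
move=> [fr fi] [gr gi]; split.
  under eq_fun do rewrite ReM.
  by apply: measurable_funB; exact: measurable_funM.
under eq_fun do rewrite ImM.
by apply: measurable_funD; exact: measurable_funM.
Qed.

Lemma measurable_normc f :
  cmeasurable f -> measurable_fun setT (fun x => Normc.normc (f x)).
Proof.
move=> [fr fi].
have -> : (fun x => Normc.normc (f x)) =
    (fun x => (complex.Re (f x) ^+ 2 + complex.Im (f x) ^+ 2) `^ 2^-1).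
  apply/funext => x; rewrite powR12_sqrt ?addr_ge0 ?sqr_ge0//.
  by case: (f x).
apply: (measurableT_comp (f := fun t : R => t `^ 2^-1)).
  exact: measurable_powR.
by apply: measurable_funD; apply: measurable_funX.
Qed.

Variable mu : {measure set T -> \bar R}.

(** The modulus dominates the absolute values of both coordinates and is
    dominated by their sum. *)
Lemma cintegrableP f : cintegrable mu setT f <->
  cmeasurable f /\ (\int[mu]_x (Normc.normc (f x))%:E < +oo)%E.
Proof.
split=> [[fr fi]|[[fr fi] nf]].
  have mf : cmeasurable f.
    by split; apply/measurable_EFinP; [exact: measurable_int fr|exact: measurable_int fi].
  split=> //.
  have ifi := integrableD measurableT (integrable_abse fr) (integrable_abse fi).
  apply: le_lt_trans (integrable_lty measurableT ifi).
  apply: ge0_le_integral => //=.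
  - by move=> x _; rewrite lee_fin normc_ge0.
  - by apply/measurable_EFinP; exact: measurable_normc.
  - exact: measurable_int ifi.
  - by move=> x _; rewrite -EFinD lee_fin normc_le_ReIm.
split; apply/integrableP; (split; first exact/measurable_EFinP);
  apply: le_lt_trans nf; apply: ge0_le_integral => //=.
- by apply/measurable_EFinP; apply: measurableT_comp.
- by apply/measurable_EFinP; exact: measurable_normc.
- by move=> x _; rewrite lee_fin normr_Re_le.
- by apply/measurable_EFinP; apply: measurableT_comp.
- by apply/measurable_EFinP; exact: measurable_normc.
- by move=> x _; rewrite lee_fin normr_Im_le.
Qed.

Lemma eq_cintegral f g : f =1 g -> cintegral mu setT f = cintegral mu setT g.
Proof. by move=> /funext ->. Qed.

Lemma cintegrableD f g : cintegrable mu setT f -> cintegrable mu setT g ->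
  cintegrable mu setT (fun x => f x + g x).
Proof.
move=> [fr fi] [gr gi]; split.
  under eq_fun do rewrite ReD EFinD; exact: integrableD.
under eq_fun do rewrite ImD EFinD; exact: integrableD.
Qed.

Lemma cintegralD f g : cintegrable mu setT f -> cintegrable mu setT g ->
  cintegral mu setT (fun x => f x + g x) =
  cintegral mu setT f + cintegral mu setT g.
Proof.
move=> [fr fi] [gr gi]; apply: complex_eqP; rewrite ?ReD ?ImD/= /cintegral/=.
  by rewrite -RintegralD//; apply: eq_Rintegral => x _; rewrite ReD.
by rewrite -RintegralD//; apply: eq_Rintegral => x _; rewrite ImD.
Qed.

Lemma cintegral0 : cintegral mu setT (fun=> 0 : R[i]) = 0.
Proof. by apply: complex_eqP; rewrite /= /Rintegral integral0. Qed.

Lemma cintegrableZ (c : R[i]) f : cintegrable mu setT f ->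
  cintegrable mu setT (fun x => c * f x).
Proof.
move=> /cintegrableP[mf nf]; apply/cintegrableP; split.
  by apply: cmeasurableM => //; exact: cmeasurable_cst.
under eq_integral do rewrite Normc.normcM EFinM.
rewrite ge0_integralZl//.
- by apply: lte_mul_pinfty; rewrite ?lee_fin ?normc_ge0.
- by apply/measurable_EFinP; exact: measurable_normc.
- by move=> x _; rewrite lee_fin normc_ge0.
- by rewrite lee_fin normc_ge0.
Qed.

Lemma cintegralZ (c : R[i]) f : cintegrable mu setT f ->
  cintegral mu setT (fun x => c * f x) = c * cintegral mu setT f.
Proof.
move=> [fr fi]; apply: complex_eqP; rewrite ?ReM ?ImM/=.
  rewrite -!RintegralZl//.
  rewrite -RintegralB//; last 2 first.
  - by rewrite /comp; under eq_fun do rewrite EFinM; exact: integrableZl.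
  - by rewrite /comp; under eq_fun do rewrite EFinM; exact: integrableZl.
  by apply: eq_Rintegral => x _; rewrite ReM.
rewrite -!RintegralZl//.
rewrite -RintegralD//; last 2 first.
- by rewrite /comp; under eq_fun do rewrite EFinM; exact: integrableZl.
- by rewrite /comp; under eq_fun do rewrite EFinM; exact: integrableZl.
by apply: eq_Rintegral => x _; rewrite ImM.
Qed.

Lemma cintegral_mkcond D f :
  cintegral mu D f = cintegral mu setT (fun x => if x \in D then f x else 0).
Proof.
apply: complex_eqP; rewrite /cintegral/= Rintegral_mkcond;
  by apply: eq_Rintegral => x _; rewrite !patchE; case: ifPn.
Qed.

Lemma cintegrable_mkcond D f : measurable D ->
  cintegrable mu setT (fun x => if x \in D then f x else 0) -> cintegrable mu D f.
Proof.
move=> mD [fr fi]; split; apply/(integrable_mkcond _ mD).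
  by apply: eq_integrable fr => // x _; rewrite !patchE; case: ifPn.
by apply: eq_integrable fi => // x _; rewrite !patchE; case: ifPn.
Qed.

(** Multiplying by a constant of modulus one turns the integral into a real
    number, equal to its modulus, and real parts are bounded by moduli. *)
Lemma normc_cintegral_le f : cintegrable mu setT f ->
  Normc.normc (cintegral mu setT f) <=
  fine (\int[mu]_x (Normc.normc (f x))%:E).
Proof.
move=> intf; have /cintegrableP[mf nf] := intf.
set I := cintegral mu setT f.
have [I0|I0] := eqVneq I 0.
  by rewrite I0 Normc.normc0 fine_ge0// integral_ge0// => x _; rewrite lee_fin normc_ge0.
pose c := I^-1 * (Normc.normc I)%:C.
have nI : Normc.normc I != 0 by rewrite normc_eq0.
have nc : Normc.normc c = 1.
  by rewrite Normc.normcM Normc.normcV normc_real ger0_norm ?normc_ge0// mulVf.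
have : cintegral mu setT (fun x => c * f x) = (Normc.normc I)%:C.
  by rewrite cintegralZ// -/I mulrAC mulVf// mul1r.
move=> /(congr1 (@complex.Re R))/= <-.
have [rc ic] := cintegrableZ c intf.
rewrite /Rintegral fine_le//.
- exact: integrable_fin_num.
- by rewrite ge0_fin_numE// integral_ge0// => x _; rewrite lee_fin normc_ge0.
apply: le_integral => //.
- apply/integrableP; split; first by apply/measurable_EFinP; exact: measurable_normc.
  by under eq_integral do rewrite /= ger0_norm ?normc_ge0//.
- move=> x _; rewrite lee_fin (le_trans (ler_norm _))//.
  by rewrite (le_trans (normr_Re_le _))// Normc.normcM nc mul1r.
Qed.

End complex_integral.

(** * Fubini's theorem for complex integrands *)

Section fubini.
Context d1 d2 (T1 : measurableType d1) (T2 : measurableType d2) (R : realType).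
Variable m1 : {sigma_finite_measure set T1 -> \bar R}.
Variable m2 : {sigma_finite_measure set T2 -> \bar R}.

(** The inner integral is finite for almost every [x] only; on the exceptional
    null set [Rintegral] takes a default value that the outer integral ignores. *)
Lemma Rintegral12_prod (f : T1 * T2 -> R) :
  (m1 \x m2)%E.-integrable setT (EFin \o f) ->
  \int[m1]_x (\int[m2]_y f (x, y)) = \int[(m1 \x m2)%E]_z f z.
Proof.
move=> intf; rewrite [RHS]/Rintegral -(integral12_prod_meas1 intf).
congr fine; have iF := integrable_fubini_F intf.
apply: ae_eq_integral => //.
- apply/measurable_EFinP; apply: measurableT_comp => //.
  exact: measurable_int iF.
- exact: measurable_int iF.
- have := integrable_ae measurableT iF.
  by apply: filterS => x /(_ I) fx _; rewrite /Rintegral fineK.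
Qed.

Lemma Rintegral21_prod (f : T1 * T2 -> R) :
  (m1 \x m2)%E.-integrable setT (EFin \o f) ->
  \int[m2]_y (\int[m1]_x f (x, y)) = \int[(m1 \x m2)%E]_z f z.
Proof.
move=> intf; rewrite [RHS]/Rintegral -(integral21_prod_meas1 intf).
congr fine; have mG := measurable_fubini_G intf.
apply: ae_eq_integral => //.
- by apply/measurable_EFinP; exact: measurableT_comp mG.
- have := ae_integrable2 intf; apply: filterS => y fy _.
  by rewrite /Rintegral fineK//; exact: integrable_fin_num fy.
Qed.

Lemma cintegral12_prod (h : T1 * T2 -> R[i]) :
  cintegrable (m1 \x m2)%E setT h ->
  cintegral m1 setT (fun x => cintegral m2 setT (fun y => h (x, y))) =
  cintegral (m1 \x m2)%E setT h.
Proof.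
move=> [hr hi]; apply: complex_eqP; rewrite /cintegral/=.
  exact: (Rintegral12_prod hr).
exact: (Rintegral12_prod hi).
Qed.

Lemma cintegral21_prod (h : T1 * T2 -> R[i]) :
  cintegrable (m1 \x m2)%E setT h ->
  cintegral m2 setT (fun y => cintegral m1 setT (fun x => h (x, y))) =
  cintegral (m1 \x m2)%E setT h.
Proof.
move=> [hr hi]; apply: complex_eqP; rewrite /cintegral/=.
  exact: (Rintegral21_prod hr).
exact: (Rintegral21_prod hi).
Qed.

Lemma cintegrable_tonelli (h : T1 * T2 -> R[i]) : cmeasurable h ->
  (\int[m1]_x \int[m2]_y (Normc.normc (h (x, y)))%:E < +oo)%E ->
  cintegrable (m1 \x m2)%E setT h.
Proof.
move=> mh fin; apply/cintegrableP; split => //.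
rewrite (fubini_tonelli1 (fun z => (Normc.normc (h z))%:E))//.
  by apply/measurable_EFinP; exact: measurable_normc.
by move=> x; rewrite lee_fin normc_ge0.
Qed.

Lemma cmeasurable_fst (f : T1 -> R[i]) :
  cmeasurable f -> cmeasurable (fun z : T1 * T2 => f z.1).
Proof.
move=> [fr fi]; split.
  exact: (measurableT_comp (f := fun x => complex.Re (f x)) fr measurable_fst).
exact: (measurableT_comp (f := fun x => complex.Im (f x)) fi measurable_fst).
Qed.

Lemma cmeasurable_snd (f : T2 -> R[i]) :
  cmeasurable f -> cmeasurable (fun z : T1 * T2 => f z.2).
Proof.
move=> [fr fi]; split.
  exact: (measurableT_comp (f := fun x => complex.Re (f x)) fr measurable_snd).
exact: (measurableT_comp (f := fun x => complex.Im (f x)) fi measurable_snd).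
Qed.

(** Stated over iterated integrals, this serves both to prove the integrability
    of a tensor product and to compute its norm. *)
Lemma integral_tensor (f : T1 -> R) (g : T2 -> R) :
  measurable_fun setT f -> measurable_fun setT g ->
  (forall x, 0 <= f x) -> (forall y, 0 <= g y) ->
  (\int[m1]_x \int[m2]_y (f x * g y)%:E =
   \int[m1]_x (f x)%:E * \int[m2]_y (g y)%:E)%E.
Proof.
move=> mf mg f0 g0.
under eq_integral => x _.
  under eq_integral do rewrite EFinM.
  rewrite ge0_integralZl//; [|exact/measurable_EFinP|by move=> y _; rewrite lee_fin|by rewrite lee_fin].
  over.
rewrite ge0_integralZr//; first exact/measurable_EFinP.
- by move=> x _; rewrite lee_fin.
- by apply: integral_ge0 => y _; rewrite lee_fin.
Qed.

Lemma cintegrable_tensor (f : T1 -> R[i]) (g : T2 -> R[i]) :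
  cintegrable m1 setT f -> cintegrable m2 setT g ->
  cintegrable (m1 \x m2)%E setT (fun z => f z.1 * g z.2).
Proof.
move=> /cintegrableP[mf nf] /cintegrableP[mg ng].
apply: cintegrable_tonelli.
  by apply: cmeasurableM; [exact: cmeasurable_fst|exact: cmeasurable_snd].
under eq_integral do under eq_integral do rewrite /= Normc.normcM.
rewrite integral_tensor//; last 4 first.
- exact: measurable_normc.
- exact: measurable_normc.
- by move=> x; exact: normc_ge0.
- by move=> x; exact: normc_ge0.
rewrite lte_mul_pinfty//.
- by apply: integral_ge0 => y _; rewrite lee_fin normc_ge0.
- rewrite ge0_fin_numE//.
  by apply: integral_ge0 => y _; rewrite lee_fin normc_ge0.
Qed.

Lemma cintegral_tensor (f : T1 -> R[i]) (g : T2 -> R[i]) :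
  cintegrable m1 setT f -> cintegrable m2 setT g ->
  cintegral (m1 \x m2)%E setT (fun z => f z.1 * g z.2) =
  cintegral m1 setT f * cintegral m2 setT g.
Proof.
move=> intf intg; rewrite -cintegral12_prod/=; last exact: cintegrable_tensor.
under eq_cintegral do rewrite cintegralZ// mulrC.
by rewrite cintegralZ// mulrC.
Qed.

End fubini.

(** * Affine changes of variable *)

Section affine_change.
Context {R : realType}.
Local Notation mu := (@lebesgue_measure R).

Definition affine (a b x : measurableTypeR R) : measurableTypeR R := a * x + b.

Lemma measurable_affine a b : measurable_fun setT (affine a b).
Proof. by apply: measurable_funD => //; exact: measurable_funM. Qed.

(** The pushforward rescaled by [a] agrees with the Lebesgue measure on half-open
    intervals, hence everywhere by uniqueness. *)
Lemma lebesgue_measure_affine (a b : R) (A : set R) : 0 < a ->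
  measurable A -> pushforward mu (affine a b) A = (a^-1%:E * mu A)%E.
Proof.
move=> a0 mA; have ma := measurable_affine a b.
pose k : {nonneg R} := NngNum (ltW a0).
have -> : mu A = mscale k (pushforward mu (affine a b)) A.
  move=> m; apply: lebesgue_measure_unique => //= _ [[c e]] _ <-.
  rewrite /mscale /= /pushforward.
  have -> : affine a b @^-1` `]c, e] = `](c - b) / a, (e - b) / a]%classic.
    by apply/seteqP; split => x /=; rewrite /affine !in_itv/=
      ltr_pdivrMr// ler_pdivlMr// ltrBlDr lerBrDr mulrC.
  rewrite !lebesgue_measure_itv/= !lte_fin ltr_pM2r ?invr_gt0// ltrD2r.
  case: ifPn => // _; last by rewrite mule0.
  by rewrite -!EFinB -EFinM; congr EFin; field; rewrite gt_eqF.
by rewrite /mscale muleA -EFinM mulVf ?gt_eqF// mul1e.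
Qed.

Lemma ge0_integral_affine (a b : R) (f : R -> \bar R) : 0 < a ->
  measurable_fun setT f -> (forall x, 0 <= f x)%E ->
  (\int[mu]_x f (a * x + b)%R = a^-1%:E * \int[mu]_x f x)%E.
Proof.
move=> a0 mf f0; have ma := measurable_affine a b.
have ai0 : 0 <= a^-1 by rewrite invr_ge0 ltW.
transitivity (\int[pushforward mu (affine a b)]_x f x)%E.
  by rewrite ge0_integral_pushforward// preimage_setT.
rewrite -[a^-1]/((NngNum ai0)%:num) -ge0_integral_mscale//.
apply: eq_measure_integral => A mA _.
exact: (lebesgue_measure_affine b a0 mA).
Qed.

Lemma integral_affine (a b : R) (f : R -> R) : 0 < a ->
  mu.-integrable setT (EFin \o f) ->
  \int[mu]_x f (a * x + b) = a^-1 * \int[mu]_x f x.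
Proof.
move=> a0 intf.
rewrite /Rintegral integralE [in RHS]integralE.
have mf := measurable_int _ intf.
have ip := integrable_funepos measurableT intf.
have im := integrable_funeneg measurableT intf.
have ep := @ge0_integral_affine a b (EFin \o f)^\+%E a0 (measurable_funepos mf).
have em := @ge0_integral_affine a b (EFin \o f)^\-%E a0 (measurable_funeneg mf).
under eq_integral do rewrite (funepos_comp (EFin \o f) (fun x => a * x + b))/=.
under [X in (_ - X)%E]eq_integral do
  rewrite (funeneg_comp (EFin \o f) (fun x => a * x + b))/=.
rewrite ep// em//.
have fp := integrable_fin_num measurableT ip.
have fm := integrable_fin_num measurableT im.
rewrite -muleBr//; last by rewrite fin_num_adde_defr.
by rewrite fineM// fin_numB fp fm.
Qed.

Lemma cintegrable_affine (a b : R) (f : R -> R[i]) : 0 < a ->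
  cintegrable mu setT f -> cintegrable mu setT (fun x => f (a * x + b)).
Proof.
move=> a0 /cintegrableP[[mr mi] nf]; apply/cintegrableP; split.
  by split; [apply: (measurableT_comp mr)|apply: (measurableT_comp mi)];
    apply: measurable_funD => //; exact: measurable_funM.
rewrite (@ge0_integral_affine a b (fun x => (Normc.normc (f x))%:E))//.
- by apply: lte_mul_pinfty => //; rewrite lee_fin invr_ge0 ltW.
- by apply/measurable_EFinP; exact: measurable_normc.
- by move=> x; rewrite lee_fin normc_ge0.
Qed.

Lemma cintegral_affine (a b : R) (f : R -> R[i]) : 0 < a ->
  cintegrable mu setT f ->
  cintegral mu setT (fun x => f (a * x + b)) =
  (a^-1)%:C * cintegral mu setT f.
Proof.
move=> a0 [fr fi]; apply: complex_eqP; rewrite ?ReM ?ImM /cintegral/= mul0r.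
  by rewrite subr0 -(@integral_affine a b).
by rewrite addr0 -(@integral_affine a b).
Qed.

End affine_change.

(** * Square partial sums and termwise integration *)

Section square_sums.
Context {R : realType}.
Implicit Types (a c : nat -> nat -> R) (u : nat -> nat -> R[i]).

(** [dseries] is the coordinatewise limit of these sums. *)
Definition sqsum (V : nmodType) (a : nat -> nat -> V) (N : nat) : V :=
  \sum_(m < N) \sum_(n < N) a m n.

Lemma sqsumS a N : sqsum a N.+1 =
  sqsum a N + (\sum_(m < N) a m N + \sum_(n < N.+1) a N n).
Proof.
rewrite /sqsum big_ord_recr/= addrA -big_split/=; congr (_ + _).
by apply: eq_bigr => m _; rewrite big_ord_recr.
Qed.

Lemma sqsum_nondecreasing a : (forall m n, 0 <= a m n) ->
  nondecreasing_seq (sqsum a).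
Proof.
move=> a0; apply/nondecreasing_seqP => N; rewrite sqsumS lerDl.
by rewrite addr_ge0// sumr_ge0.
Qed.

Lemma sqsumD a c N :
  sqsum (fun m n => a m n + c m n) N = sqsum a N + sqsum c N.
Proof.
by rewrite /sqsum -big_split/=; apply: eq_bigr => m _; rewrite -big_split.
Qed.

Lemma sqsumZ (k : R) a N : sqsum (fun m n => k * a m n) N = k * sqsum a N.
Proof.
by rewrite /sqsum mulr_sumr; apply: eq_bigr => m _; rewrite mulr_sumr.
Qed.

Lemma ler_norm_sqsum a c N : (forall m n, `|a m n| <= c m n) ->
  `|sqsum a N| <= sqsum c N.
Proof.
move=> ac; rewrite (le_trans (ler_norm_sum _ _ _))//; apply: ler_sum => m _.
by rewrite (le_trans (ler_norm_sum _ _ _))//; apply: ler_sum.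
Qed.

(** [a] is the difference of [a + c] and [c], whose entries are nonnegative and
    whose square sums are therefore monotone and bounded. *)
Lemma is_cvg_sqsum a c (B : R) : (forall m n, `|a m n| <= c m n) ->
  (forall N, sqsum c N <= B) -> cvgn (sqsum a).
Proof.
move=> ac cB.
have c0 m n : 0 <= c m n by rewrite (le_trans _ (ac m n)).
have cvgc : cvgn (sqsum c).
  apply: nondecreasing_is_cvgn; first exact: sqsum_nondecreasing.
  by exists B => _ [N _ <-].
have cvgac : cvgn (sqsum (fun m n => a m n + c m n)).
  apply: nondecreasing_is_cvgn.
    apply: sqsum_nondecreasing => m n.
    by rewrite -lerBlDr sub0r; have := ac m n; rewrite ler_norml => /andP[].
  exists (B + B) => _ [N _ <-]; rewrite sqsumD lerD//.
  by rewrite (le_trans _ (cB N))// (le_trans (ler_norm _))// ler_norm_sqsum.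
rewrite (_ : sqsum a = sqsum (fun m n => a m n + c m n) \- sqsum c).
  exact: is_cvgB.
by apply/funext => N /=; rewrite sqsumD addrK.
Qed.

(** Absolute convergence read on the square partial sums. *)
Definition sq_bounded u :=
  exists B, forall N, sqsum (fun m n => Normc.normc (u m n)) N <= B.

Lemma sq_boundedZ (k : R[i]) u :
  sq_bounded u -> sq_bounded (fun m n => k * u m n).
Proof.
move=> [B uB]; exists (Normc.normc k * B) => N.
rewrite (_ : (fun m n => _) = (fun m n => Normc.normc k * Normc.normc (u m n))).
  by rewrite sqsumZ ler_wpM2l ?normc_ge0.
by apply/funext => m; apply/funext => n; rewrite Normc.normcM.
Qed.

Lemma dseries_abs_cvg_bounded u : dseries_abs_cvg u -> sq_bounded u.
Proof.
rewrite /dseries_abs_cvg /summable => fin.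
set S := esum _ _ in fin.
have S0 : (0 <= S)%E by exact: esum_ge0.
exists (fine S) => N; rewrite -lee_fin fineK ?ge0_fin_numE//.
pose s := [seq (m, n) | m <- iota 0 N, n <- iota 0 N].
have us : uniq s.
  by apply: allpairs_uniq; rewrite ?iota_uniq//; move=> [? ?] [? ?].
apply: esum_ge; exists [set` s]; first by split => //; exact: finite_seq.
rewrite -fsbig_seq// big_allpairs_dep/= /sqsum.
rewrite -(big_mkord xpredT (fun m => \sum_(n < N) Normc.normc (u m n))).
rewrite -sumEFin /index_iota subn0; apply: lee_sum => m _.
rewrite -(big_mkord xpredT (fun n => Normc.normc (u m n))) -sumEFin.
rewrite /index_iota subn0; apply: lee_sum => n _.
by rewrite lee_fin ler_norm.
Qed.

Lemma dseriesZ (k : R[i]) u : sq_bounded u ->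
  dseries (fun m n => k * u m n) = k * dseries u.
Proof.
move=> [B uB].
have cr : cvgn (sqsum (fun m n => complex.Re (u m n))).
  by apply: is_cvg_sqsum uB => m n; exact: normr_Re_le.
have ci : cvgn (sqsum (fun m n => complex.Im (u m n))).
  by apply: is_cvg_sqsum uB => m n; exact: normr_Im_le.
apply: complex_eqP; rewrite ?ReM ?ImM/=; apply/cvg_lim => //.
  rewrite (_ : (fun _ => _) = (fun N =>
    complex.Re k * sqsum (fun m n => complex.Re (u m n)) N -
    complex.Im k * sqsum (fun m n => complex.Im (u m n)) N)).
    by apply: cvgB; apply: cvgMr.
  apply/funext => N; rewrite -!sqsumZ -sumrB; apply: eq_bigr => m _.
  by rewrite -sumrB; apply: eq_bigr => n _; rewrite ReM.
rewrite (_ : (fun _ => _) = (fun N =>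
  complex.Re k * sqsum (fun m n => complex.Im (u m n)) N +
  complex.Im k * sqsum (fun m n => complex.Re (u m n)) N)).
  by apply: cvgD; apply: cvgMr.
apply/funext => N; rewrite -!sqsumZ -big_split/=; apply: eq_bigr => m _.
by rewrite -big_split; apply: eq_bigr => n _; rewrite ImM.
Qed.

End square_sums.

Section termwise_integration.
Context d (T : measurableType d) (R : realType).
Variable mu : {measure set T -> \bar R}.

Lemma measurable_sqsum (a : nat -> nat -> T -> R) N :
  (forall m n, measurable_fun setT (a m n)) ->
  measurable_fun setT (fun x => sqsum (fun m n => a m n x) N).
Proof.
by move=> ma; apply: measurable_sum => m; exact: measurable_sum.
Qed.

Lemma integral_sqsum_le (c : nat -> nat -> T -> R) (M : nat -> nat -> R) N :
  (forall m n, measurable_fun setT (c m n)) ->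
  (forall m n x, 0 <= c m n x) ->
  (forall m n, \int[mu]_x (c m n x)%:E <= (M m n)%:E)%E ->
  (\int[mu]_x (sqsum (fun m n => c m n x) N)%:E <= (sqsum M N)%:E)%E.
Proof.
move=> mc c0 cM; rewrite /sqsum.
under eq_integral do rewrite -sumEFin.
rewrite ge0_integral_sum//=; last 2 first.
- by move=> m; apply/measurable_EFinP; exact: measurable_sum.
- by move=> m x _; rewrite lee_fin sumr_ge0.
rewrite -sumEFin; apply: lee_sum => m _.
under eq_integral do rewrite -sumEFin.
rewrite ge0_integral_sum//=; last 2 first.
- by move=> n; apply/measurable_EFinP.
- by move=> n x _; rewrite lee_fin.
by rewrite -sumEFin; apply: lee_sum.
Qed.

(** Dominated convergence. The majorant is the increasing limit of the square
    sums of [c]; it is integrable by monotone convergence, since the integrals of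
    these sums stay below [B]. *)
Lemma Rintegral_lim_sqsum (a c : nat -> nat -> T -> R) (M : nat -> nat -> R) B :
  (forall m n, measurable_fun setT (a m n)) ->
  (forall m n, measurable_fun setT (c m n)) ->
  (forall m n x, `|a m n x| <= c m n x) ->
  (forall m n, \int[mu]_x (c m n x)%:E <= (M m n)%:E)%E ->
  (forall N, sqsum M N <= B) ->
  (forall x, exists B', forall N, sqsum (fun m n => c m n x) N <= B') ->
  let S x := limn (sqsum (fun m n => a m n x)) in
  mu.-integrable setT (EFin \o S) /\
  \int[mu]_x S x = limn (sqsum (fun m n => \int[mu]_x a m n x)).
Proof.
move=> ma mc ac cM MB cB S.
have c0 m n x : 0 <= c m n x by rewrite (le_trans _ (ac m n x)).
have ia m n : mu.-integrable setT (EFin \o a m n).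
  apply/integrableP; split; first exact/measurable_EFinP.
  apply: le_lt_trans (ltry (M m n)); apply: le_trans (cM m n).
  apply: ge0_le_integral => //=.
  - by apply/measurable_EFinP; exact: measurableT_comp.
  - exact/measurable_EFinP.
  - by move=> x _; rewrite lee_fin ac.
pose G N x := (sqsum (fun m n => c m n x) N)%:E.
have mG N : measurable_fun setT (G N).
  by apply/measurable_EFinP; exact: measurable_sqsum.
have G0 N x : (0 <= G N x)%E.
  by rewrite lee_fin /sqsum sumr_ge0// => m _; rewrite sumr_ge0.
have ndG x : nondecreasing_seq (G ^~ x).
  move=> N N' NN'; rewrite lee_fin; exact: sqsum_nondecreasing.
have cvgG x : cvgn (G ^~ x) by exact: ereal_nondecreasing_is_cvgn.
pose g x := limn (G ^~ x).
have mg : measurable_fun setT g by apply: (emeasurable_fun_cvg G) => // x _.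
have g0 x : (0 <= g x)%E by apply: lime_ge => //; exact: nearW.
have ig : mu.-integrable setT g.
  apply/integrableP; split => //.
  under eq_integral do rewrite gee0_abs//.
  rewrite monotone_convergence//.
  apply: le_lt_trans (ltry B); apply: lime_le.
    apply: ereal_nondecreasing_is_cvgn => N N' NN'.
    by apply: ge0_le_integral => // x _; exact: ndG.
  apply: nearW => N; apply: le_trans (integral_sqsum_le N mc c0 cM) _.
  by rewrite lee_fin.
have cvgS x : sqsum (fun m n => a m n x) @ \oo --> S x.
  have [B' cB'] := cB x.
  by apply: is_cvg_sqsum cB' => m n; exact: ac.
have mS : measurable_fun setT (EFin \o S).
  apply/measurable_EFinP.
  by apply: (measurable_fun_cvg (fun N => measurable_sqsum N ma)).
have [] := @dominated_convergence _ T R mu setT measurableT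
  (fun N x => (sqsum (fun m n => a m n x) N)%:E) (EFin \o S) g.
- by move=> N; apply/measurable_EFinP; exact: measurable_sqsum.
- exact: mS.
- by apply: aeW => x _; apply: cvg_EFin; [exact: nearW|exact: cvgS].
- exact: ig.
- apply: aeW => x N _; apply: (@le_trans _ _ (G N x)).
    by rewrite lee_fin ler_norm_sqsum// => m n; exact: ac.
  apply: lime_ge => //; exists N => // N' /= NN'; exact: ndG.
move=> iS _ cvgI; split => //.
apply/esym/cvg_lim => //.
rewrite [X in X @ _ --> _](_ : _ =
    fun N => fine (\int[mu]_x (sqsum (fun m n => a m n x) N)%:E)%E).
  apply: fine_cvg; rewrite fineK//; exact: integrable_fin_num.
apply/funext => N; rewrite /sqsum.
under eq_integral do rewrite -sumEFin.
have is1 (m : 'I_N) : mu.-integrable setT (fun x => (\sum_(n < N) a m n x)%:E).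
  rewrite (_ : (fun x => _) = (fun x => \sum_(n < N) (EFin \o a m n) x)%E).
    by apply: integrable_sum => // n _; exact: ia.
  by apply/funext => x; rewrite -sumEFin.
rewrite integral_sum//= -[LHS]/(fine (_%:E)); congr fine.
rewrite -sumEFin; apply: eq_bigr => m _; rewrite -sumEFin.
under [in RHS]eq_integral do rewrite -sumEFin.
rewrite integral_sum//=; last by move=> n; exact: ia.
by apply: eq_bigr => n _; rewrite fineK//; exact: integrable_fin_num (ia _ _).
Qed.

Lemma cintegral_dseries (f : nat -> nat -> T -> R[i]) (M : nat -> nat -> R) B :
  (forall m n, cmeasurable (f m n)) ->
  (forall m n, \int[mu]_x (Normc.normc (f m n x))%:E <= (M m n)%:E)%E ->
  (forall N, sqsum M N <= B) ->
  (forall x, sq_bounded (fun m n => f m n x)) ->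
  cintegrable mu setT (fun x => dseries (fun m n => f m n x)) /\
  cintegral mu setT (fun x => dseries (fun m n => f m n x)) =
  dseries (fun m n => cintegral mu setT (f m n)).
Proof.
move=> mf fM MB cf.
have [ir er] := Rintegral_lim_sqsum (fun m n => (mf m n).1)
  (fun m n => measurable_normc (mf m n)) (fun m n x => normr_Re_le (f m n x))
  fM MB cf.
have [ii ei] := Rintegral_lim_sqsum (fun m n => (mf m n).2)
  (fun m n => measurable_normc (mf m n)) (fun m n x => normr_Im_le (f m n x))
  fM MB cf.
by split => //; apply: complex_eqP.
Qed.

End termwise_integration.

(** * The fundamental theorem of calculus on the half-line *)

Section ftc_half_line.
Context {R : realType}.
Local Notation mu := (@lebesgue_measure R).
Variables (F f : R -> R).
Hypothesis F_deriv : forall t : R, 0 < t -> is_derive t 1 F (f t).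
Hypothesis f_cont : forall t : R, 0 < t -> {for t, continuous f}.

(* Compact intervals exhausting the open half-line; the right end n + 2 keeps
   the interval nondegenerate for n = 0. *)
Let A (n : nat) : set R := `[n.+1%:R^-1, n.+2%:R]%classic.

Let bounds_lt (n : nat) : (n.+1%:R : R)^-1 < n.+2%:R.
Proof.
rewrite (@le_lt_trans _ _ 1)// ?ltr1n//.
by rewrite invf_le1 ?ltr0n// ler1n.
Qed.

Let nondecreasing_A : nondecreasing_seq A.
Proof.
move=> m n mn; apply/subsetPset => t; rewrite /A /= !in_itv/= => /andP[lt ut].
rewrite (le_trans _ lt)/= ?(le_trans ut)// ?ler_nat//.
by rewrite lef_pV2 ?posrE ?ltr0n// ler_nat.
Qed.

Let bigcup_A : \bigcup_n A n = `]0, +oo[%classic.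
Proof.
apply/seteqP; split => t; rewrite /= in_itv/= andbT.
  move=> [n _]; rewrite /A/= in_itv/= => /andP[+ _].
  by apply: lt_le_trans; rewrite invr_gt0 ltr0n.
move=> t0; pose k := maxn (Num.truncn t) (Num.truncn t^-1).
exists k => //; rewrite /A/= in_itv/=; apply/andP; split.
  rewrite invf_ple ?posrE ?ltr0n//.
  rewrite (le_trans (ltW (truncnS_gt _)))// ler_nat ltnS; exact: leq_maxr.
rewrite (le_trans (ltW (truncnS_gt _)))// ler_nat.
by rewrite ltnS (leq_trans (leq_maxl _ _) (leqnSn _)).
Qed.

Let integral_A n :
  (\int[mu]_(t in A n) (f t)%:E = (F n.+2%:R - F n.+1%:R^-1)%:E)%E.
Proof.
have F_cont (t : R) : 0 < t -> {for t, continuous F}.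
  by move=> t0; apply/differentiable_continuous/derivable1_diffP; case: (F_deriv t0).
have inv0 : 0 < (n.+1%:R : R)^-1 by rewrite invr_gt0 ltr0n.
rewrite EFinB (@continuous_FTC2 _ f F)//.
- apply: continuous_in_subspaceT => t; rewrite inE/= in_itv/= => /andP[lt _].
  by apply: f_cont; exact: lt_le_trans lt.
- split.
  + move=> t; rewrite in_itv/= => /andP[lt _].
    have t0 : 0 < t by exact: lt_trans lt.
    by case: (F_deriv t0).
  + by apply/cvg_at_right_filter/F_cont.
  + by apply/cvg_at_left_filter/F_cont.
- move=> t; rewrite in_itv/= => /andP[lt _].
  have t0 : 0 < t by exact: lt_trans lt.
  by rewrite derive1E; case: (F_deriv t0).
Qed.

Let measurable_A n : measurable (A n). Proof. exact: measurable_itv. Qed.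

Lemma ge0_integral_FTC_bounded (C : R) :
  measurable_fun (`]0, +oo[%classic : set R) f ->
  (forall t : R, 0 < t -> 0 <= f t) ->
  (forall s t : R, 0 < s -> 0 < t -> F t - F s <= C) ->
  (\int[mu]_(t in `]0%R, +oo[) (f t)%:E <= C%:E)%E.
Proof.
move=> mf f0 FC; rewrite -bigcup_A.
have sub n : A n `<=` `]0, +oo[ by rewrite -bigcup_A; exact: bigcup_sup.
have mfA n : measurable_fun (A n) (EFin \o f).
  by apply/measurable_EFinP; exact: measurable_funS mf.
have f0A n t : A n t -> (0 <= (f t)%:E)%E.
  by move=> /sub; rewrite /= in_itv/= andbT lee_fin => /f0.
have cv : (\int[mu]_(t in A n) (f t)%:E @[n --> \oo] -->
    \int[mu]_(t in \bigcup_n A n) (f t)%:E)%E.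
  exact: ge0_nondecreasing_set_cvg_integral.
rewrite -(cvg_lim _ cv)//; apply: lime_le; first by apply/cvg_ex; eexists; exact: cv.
by apply: nearW => n; rewrite integral_A lee_fin FC ?invr_gt0 ?ltr0n.
Qed.

(** The integrals of the positive and negative parts over the exhausting
    intervals converge separately, by monotone convergence. *)
Lemma integral_FTC_lim (l : R) : mu.-integrable `]0, +oo[ (EFin \o f) ->
  F n.+2%:R - F n.+1%:R^-1 @[n --> \oo] --> l ->
  \int[mu]_(t in `]0, +oo[) f t = l.
Proof.
move=> intf Fl.
have sub n : A n `<=` `]0, +oo[ by rewrite -bigcup_A; exact: bigcup_sup.
have ip : mu.-integrable `]0%R, +oo[ (EFin \o f)^\+%E by exact: integrable_funepos.
have im : mu.-integrable `]0%R, +oo[ (EFin \o f)^\-%E by exact: integrable_funeneg.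
have cp : (\int[mu]_(t in A n) (EFin \o f)^\+ t @[n --> \oo] -->
    \int[mu]_(t in `]0%R, +oo[) (EFin \o f)^\+ t)%E.
  rewrite -bigcup_A; apply: ge0_nondecreasing_set_cvg_integral => //.
  by move=> n; exact: measurable_funS (measurable_int _ ip).
have cm : (\int[mu]_(t in A n) (EFin \o f)^\- t @[n --> \oo] -->
    \int[mu]_(t in `]0%R, +oo[) (EFin \o f)^\- t)%E.
  rewrite -bigcup_A; apply: ge0_nondecreasing_set_cvg_integral => //.
  by move=> n; exact: measurable_funS (measurable_int _ im).
have fp : (\int[mu]_(t in `]0%R, +oo[) (EFin \o f)^\+ t)%E \is a fin_num.
  exact: integrable_fin_num.
have fm : (\int[mu]_(t in `]0%R, +oo[) (EFin \o f)^\- t)%E \is a fin_num.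
  exact: integrable_fin_num.
have c : (\int[mu]_(t in A n) (f t)%:E @[n --> \oo] -->
    \int[mu]_(t in `]0%R, +oo[) (f t)%:E)%E.
  have E D : (\int[mu]_(t in D) (f t)%:E = \int[mu]_(t in D) (EFin \o f)^\+ t -
      \int[mu]_(t in D) (EFin \o f)^\- t)%E by exact: integralE.
  rewrite E [X in X @ _ --> _](_ : _ = fun n => (\int[mu]_(t in A n) (EFin \o f)^\+ t -
      \int[mu]_(t in A n) (EFin \o f)^\- t)%E); last exact/funext.
  by apply: cvgeB => //; rewrite fin_num_adde_defr.
have cl : (\int[mu]_(t in A n) (f t)%:E @[n --> \oo] --> l%:E)%E.
  under eq_fun do rewrite integral_A.
  by apply: cvg_EFin => //; exact: nearW.
by rewrite /Rintegral (cvg_unique _ c cl).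
Qed.

End ftc_half_line.

(** * Powers cut off at the origin *)

Section power_functions.
Context {R : realType}.
Implicit Types (t a b u : R) (z w : R[i]).

(** [t `^ u] is at most [1 + t ^+ N] for an integer [N > u], and [t ^+ N] is, up to
    the factor [2 ^+ N * N`!], a term of the power series of [expR (t / 2)]. *)
Lemma expR_ge_powR u : 0 <= u -> exists2 C : R, 0 < C &
  forall t, 0 < t -> 1 + t `^ u <= C * expR (t / 2).
Proof.
move=> u0; pose N := (Num.truncn u).+1.
exists (2 + N`!%:R * 2 ^+ N) => [|t t0].
  by rewrite addr_gt0// mulr_gt0 ?ltr0n ?fact_gt0// exprn_gt0.
have tN : t `^ u <= 1 + t ^+ N.
  have [t1|t1] := leP t 1.
    apply: (@le_trans _ _ 1); last by rewrite lerDl exprn_ge0 ?ltW.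
    have : t `^ u <= 1 `^ u by rewrite ge0_ler_powR ?nnegrE// ltW.
    by rewrite powR1.
  apply: (@le_trans _ _ (t ^+ N)); last by rewrite lerDr.
  rewrite -powR_mulrn ?(ltW t0)// ler_powR ?(ltW t1)//.
  exact/ltW/truncnS_gt.
have e1 : 1 <= expR (t / 2) by rewrite -expR0 ler_expR divr_ge0 ?ltW.
have eN : t ^+ N <= N`!%:R * 2 ^+ N * expR (t / 2).
  have t2 : 0 <= t / 2 by rewrite divr_ge0 ?ltW.
  have := @expR_ge1Dxn R (t / 2) (Num.truncn u) t2; rewrite -/N => h.
  have : (t / 2) ^+ N / N`!%:R <= expR (t / 2).
    by rewrite (le_trans _ h)// lerDr.
  have -> : t ^+ N = N`!%:R * 2 ^+ N * ((t / 2) ^+ N / N`!%:R).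
    by rewrite expr_div_n; field; rewrite expf_neq0//= pnatr_eq0 -lt0n fact_gt0.
  by move=> ?; rewrite ler_wpM2l// mulr_ge0// exprn_ge0.
rewrite mulrDl; lra.
Qed.

(** Since it vanishes outside the half-line, Euler's integrals become integrals
    over the whole line, and Fubini's theorem and changes of variable need no
    domains of integration. *)
Definition pospow z t : R[i] := if 0 < t then cpowR t (z - 1) else 0.

Definition rpospow u t : R := if 0 < t then t `^ (u - 1) else 0.

Lemma rpospow_ge0 u t : 0 <= rpospow u t.
Proof. by rewrite /rpospow; case: ifP => // _; exact: powR_ge0. Qed.

Lemma normc_cpowR t z : Normc.normc (cpowR t z) = t `^ complex.Re z.
Proof.
rewrite /cpowR /= !exprMn -mulrDr cos2Dsin2 mulr1 sqrtr_sqr ger0_norm//.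
exact: powR_ge0.
Qed.

Lemma normc_pospow z t : Normc.normc (pospow z t) = rpospow (complex.Re z) t.
Proof.
rewrite /pospow /rpospow; case: ifP => _; last exact: Normc.normc0.
by rewrite normc_cpowR; case: z.
Qed.

Lemma cpowRD t z w : 0 < t -> cpowR t (z + w) = cpowR t z * cpowR t w.
Proof.
move=> t0; case: z w => [a b] [c e]; rewrite /cpowR /=; apply: complex_eqP => /=.
  rewrite powRD ?(gt_eqF t0) ?implybT// mulrDl cosD; ring.
rewrite powRD ?(gt_eqF t0) ?implybT// mulrDl sinD; ring.
Qed.

Lemma cpowRM (s t : R) z : 0 < s -> 0 < t ->
  cpowR (s * t) z = cpowR s z * cpowR t z.
Proof.
move=> s0 t0; case: z => [a b]; rewrite /cpowR /= lnM ?posrE// mulrDr.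
rewrite powRM ?ltW// cosD sinD; apply: complex_eqP => /=; ring.
Qed.

Lemma cpowR_real t u : cpowR t u%:C = (t `^ u)%:C.
Proof. by rewrite /cpowR /= mul0r cos0 sin0 mulr1 mulr0. Qed.

Lemma cpowR1 t : 0 < t -> cpowR t 1 = t%:C.
Proof. by move=> t0; rewrite -[1 in LHS]/(1%:C) cpowR_real powRr1// ltW. Qed.

Lemma measurable_rpospow u : measurable_fun setT (rpospow u).
Proof.
apply: measurable_fun_if => //.
- by apply: measurable_fun_ltr.
- by apply: measurable_funTS; exact: measurable_powR.
Qed.

Lemma cmeasurable_pospow z : cmeasurable (pospow z).
Proof.
rewrite (_ : pospow z = (fun t => (if 0 < t then 1 else 0)%:C * cpowR t (z - 1))); last first.
  by apply/funext => t; rewrite /pospow; case: ifP => _; rewrite ?mul1r// mul0r.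
apply: cmeasurableM.
  apply: cmeasurable_real; apply: measurable_fun_if => //.
  exact: measurable_fun_ltr.
split; apply: measurable_funM => /=; do ?exact: measurable_powR.
  apply: measurableT_comp => //; first by apply: continuous_measurable_fun; exact: continuous_cos.
  by apply: measurable_funM => //; exact: measurable_ln.
apply: measurableT_comp => //; first by apply: continuous_measurable_fun; exact: continuous_sin.
by apply: measurable_funM => //; exact: measurable_ln.
Qed.

Lemma measurable_expRN : measurable_fun setT (fun t : R => expR (- t)).
Proof. exact: measurableT_comp. Qed.

End power_functions.

(** * Euler's integral of the second kind *)

Section gamma_integral.
Context {R : realType}.
Local Notation mu := (@lebesgue_measure R).
Implicit Types (t u : R) (z w : R[i]).

Definition gammaker z t : R[i] := pospow z t * (expR (- t))%:C.

Definition rgammaker u t : R := rpospow u t * expR (- t).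

Lemma rgammaker_ge0 u t : 0 <= rgammaker u t.
Proof. by rewrite mulr_ge0 ?rpospow_ge0 ?expR_ge0. Qed.

Lemma normc_gammaker z t :
  Normc.normc (gammaker z t) = rgammaker (complex.Re z) t.
Proof.
by rewrite Normc.normcM normc_pospow normc_real ger0_norm ?expR_ge0.
Qed.

Lemma measurable_rgammaker u : measurable_fun setT (rgammaker u).
Proof.
by apply: measurable_funM; [exact: measurable_rpospow|exact: measurable_expRN].
Qed.

Lemma cmeasurable_gammaker z : cmeasurable (gammaker z).
Proof.
apply: cmeasurableM; first exact: cmeasurable_pospow.
by apply: cmeasurable_real; exact: measurable_expRN.
Qed.

Lemma Gamma_integralE z :
  Gamma_integral z = cintegral mu setT (gammaker z).
Proof.
rewrite /Gamma_integral cintegral_mkcond; apply: eq_cintegral => t.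
rewrite mem_setE in_itv/= andbT /gammaker /pospow.
by case: ifP => // _; rewrite mul0r.
Qed.

(** A bounded primitive whose derivative dominates a multiple of
    [t `^ (u - 1) * expR (- t)] near 0 and near infinity at once. *)
Lemma is_derive_inv1Dpow u t : 0 < t ->
  is_derive t 1 (fun t : R => - (1 + t `^ u)^-1)
    (u * t `^ (u - 1) / (1 + t `^ u) ^+ 2).
Proof.
move=> t0; have d1 := is_derive1_powR u t0.
have n0 : 1 + t `^ u != 0 by rewrite gt_eqF// addr_gt0// powR_gt0.
have d2 : is_derive t 1 (fun t : R => 1 + t `^ u) (u * t `^ (u - 1)).
  by apply: (is_derive_eq (is_deriveD (is_derive_cst _ _ _) d1)); rewrite add0r.
have d3 := is_deriveN (@is_deriveV _ (fun t : R => 1 + t `^ u) t _ _ n0 d2).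
apply: (@is_derive_eq _ _ _ (fun t : R => - (1 + t `^ u)^-1) _ _ _ _ d3).
by rewrite /GRing.scale/=; field.
Qed.

Lemma continuous_powRl u t : 0 < t -> {for t, continuous (fun t => t `^ u)}.
Proof.
move=> t0; apply/differentiable_continuous/derivable1_diffP.
by case: (is_derive1_powR u t0).
Qed.

(** By [expR_ge_powR], [expR (- t)] is at most [C ^+ 2 / (1 + t `^ u) ^+ 2], so the
    kernel is dominated by [C ^+ 2 / u] times the derivative computed in
    [is_derive_inv1Dpow]. *)
Lemma integral_rgammaker_lty u : 0 < u ->
  (\int[mu]_t (rgammaker u t)%:E < +oo)%E.
Proof.
move=> u0; have [C C0 CE] := expR_ge_powR (ltW u0).
pose f t : R := u * t `^ (u - 1) / (1 + t `^ u) ^+ 2.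
have n0 (t : R) : 0 < 1 + t `^ u by rewrite ltr_pwDl// powR_ge0.
have mf : measurable_fun (`]0, +oo[%classic : set R) f.
  apply: measurable_funTS; apply: measurable_funM.
    by apply: measurable_funM => //; exact: measurable_powR.
  rewrite (_ : (fun t => _) = (fun t : R => (1 + t `^ u) `^ (- 2%:R))); last first.
    by apply/funext => t; rewrite powR_invn// ltW.
  apply: (measurableT_comp (f := fun t : R => t `^ (- 2%:R))).
    exact: measurable_powR.
  apply: measurable_funD => //; exact: measurable_powR.
have f0 (t : R) : 0 < t -> 0 <= f t.
  move=> t0; rewrite /f divr_ge0 ?sqr_ge0// mulr_ge0 ?powR_ge0// ltW//.
have -> : (\int[mu]_t (rgammaker u t)%:E =
    \int[mu]_(t in `]0%R, +oo[) (rgammaker u t)%:E)%E.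
  rewrite [RHS]integral_mkcond; apply: eq_integral => t _.
  rewrite patchE mem_setE in_itv/= andbT; case: ifPn => //.
  by rewrite /rgammaker /rpospow => /negbTE ->; rewrite mul0r.
apply: (@le_lt_trans _ _ ((C ^+ 2 / u)%:E * 1%:E)%E); last first.
  by rewrite -EFinM ltry.
apply: (@le_trans _ _
  ((C ^+ 2 / u)%:E * \int[mu]_(t in `]0%R, +oo[) (f t)%:E)%E); last first.
  apply: lee_wpmul2l; first by rewrite lee_fin divr_ge0 ?sqr_ge0// ltW.
  apply: (@ge0_integral_FTC_bounded _ (fun t : R => - (1 + t `^ u)^-1)) => //.
  - by move=> t t0; exact: is_derive_inv1Dpow.
  - move=> t t0; apply: cvgM.
      apply: cvgM; first exact: cvg_cst.
      exact: continuous_powRl.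
    apply: cvgV; first by rewrite expf_neq0// gt_eqF.
    apply: (@cvg_comp _ _ _ (fun t : R => 1 + t `^ u) (fun y => y ^+ 2)); last first.
      exact: exprn_continuous.
    by apply: cvgD; [exact: cvg_cst|exact: continuous_powRl].
  - move=> s t s0 t0; rewrite opprK.
    rewrite (@le_trans _ _ (1 + s `^ u)^-1)//.
      by rewrite gerDr oppr_le0 invr_ge0 ltW.
    by rewrite invf_le1// lerDl powR_ge0.
rewrite -ge0_integralZl//; last 3 first.
- exact/measurable_EFinP.
- by move=> t; rewrite /= in_itv/= andbT lee_fin => /f0.
- by rewrite lee_fin divr_ge0 ?sqr_ge0// ltW.
apply: ge0_le_integral => //=.
- by move=> t _; rewrite lee_fin rgammaker_ge0.
- by apply/measurable_EFinP/measurable_funTS; exact: measurable_rgammaker.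
- by apply/measurable_EFinP; apply: measurable_funM.
move=> t; rewrite in_itv/= andbT => t0; rewrite -EFinM lee_fin.
rewrite /rgammaker /rpospow t0 /f.
have -> : C ^+ 2 / u * (u * t `^ (u - 1) / (1 + t `^ u) ^+ 2) =
    t `^ (u - 1) * (C ^+ 2 / (1 + t `^ u) ^+ 2).
  by field; rewrite !gt_eqF.
apply: ler_wpM2l; first exact: powR_ge0.
rewrite expRN -exprVn -exprMn -[X in X^-1]/(expR t).
have -> : (expR t)^-1 = (expR (t / 2))^-1 ^+ 2.
  by rewrite exprVn -expRM_natl -mulr_natl; congr (expR _)^-1; field.
rewrite ler_sqr ?nnegrE ?invr_ge0 ?expR_ge0 ?mulr_ge0 ?invr_ge0 ?(ltW C0) ?(ltW (n0 _))//.
by rewrite ler_pdivlMr// mulrC ler_pdivrMr ?expR_gt0// CE.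
Qed.

Lemma cintegrable_gammaker z : 0 < complex.Re z ->
  cintegrable mu setT (gammaker z).
Proof.
move=> z0; apply/cintegrableP; split; first exact: cmeasurable_gammaker.
under eq_integral do rewrite normc_gammaker.
exact: integral_rgammaker_lty.
Qed.

Definition rGamma u : R := \int[mu]_t rgammaker u t.

Lemma EFin_rGamma u : 0 < u ->
  ((rGamma u)%:E = \int[mu]_t (rgammaker u t)%:E)%E.
Proof.
move=> u0; rewrite /rGamma /Rintegral fineK// ge0_fin_numE.
  exact: integral_rgammaker_lty.
by apply: integral_ge0 => t _; rewrite lee_fin rgammaker_ge0.
Qed.

Lemma gammaker_real u t : gammaker u%:C t = (rgammaker u t)%:C.
Proof.
rewrite /gammaker /rgammaker /pospow /rpospow; case: ifP => _; last by rewrite !mul0r.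
by rewrite -[1](rmorph1 (real_complex R)) -rmorphB cpowR_real -rmorphM.
Qed.

Lemma Gamma_integral_real u : Gamma_integral u%:C = (rGamma u)%:C.
Proof.
rewrite Gamma_integralE; apply: complex_eqP; rewrite /cintegral/=.
  by apply: eq_Rintegral => t _; rewrite gammaker_real.
under eq_Rintegral do rewrite gammaker_real.
by rewrite /= /Rintegral integral0.
Qed.

Lemma rGamma_gt0 u : 0 < u -> 0 < rGamma u.
Proof.
move=> u0; rewrite -lte_fin EFin_rGamma//.
(* On [1, 2], t ^ (u - 1) >= 1 / t >= 1 / 2 because u > 0. *)
apply: (@lt_le_trans _ _ (\int[mu]_(t in `[1%R, 2%R]) (expR (- 2) / 2)%:E)%E).
  rewrite integral_cst//= lebesgue_measure_itv/= lte_fin ltr1n -EFinB -EFinM.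
  by rewrite lte_fin mulr_gt0 ?divr_gt0 ?expR_gt0// subr_gt0 ltr1n.
apply: (@le_trans _ _ (\int[mu]_(t in `[1%R, 2%R]) (rgammaker u t)%:E)%E).
  apply: ge0_le_integral => //=.
  - by apply/measurable_EFinP/measurable_funTS; exact: measurable_rgammaker.
  - move=> t; rewrite in_itv/= => /andP[t1 t2]; have t0 : 0 < t by lra.
    rewrite lee_fin /rgammaker /rpospow t0 mulrC ler_pM ?expR_ge0 ?ler_expR ?lerN2//.
    apply: (@le_trans _ _ (t `^ (- 1))).
      by rewrite powR_inv1 ?(ltW t0)// lef_pV2 ?posrE.
    by rewrite ler_powR//; lra.
apply: ge0_subset_integral => //.
- by apply/measurable_EFinP; exact: measurable_rgammaker.
- by move=> t _; rewrite lee_fin rgammaker_ge0.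
Qed.

Lemma normc_Gamma_integral_le z : 0 < complex.Re z ->
  Normc.normc (Gamma_integral z) <= rGamma (complex.Re z).
Proof.
move=> z0; rewrite Gamma_integralE.
apply: le_trans (normc_cintegral_le (cintegrable_gammaker z0)) _.
by rewrite /rGamma /Rintegral; under eq_integral do rewrite normc_gammaker.
Qed.

End gamma_integral.

(** * The beta integral *)

Section beta_integral.
Context {R : realType}.
Local Notation mu := (@lebesgue_measure R).
Implicit Types (s t p : R) (z w : R[i]).

Definition rbetaker (a b : R) t : R := rpospow a t * rpospow b (1 - t).

Definition betaker w z t : R[i] := pospow w t * pospow z (1 - t).

Lemma measurable_rpospow_sub (b p : R) : measurable_fun setT (fun s => rpospow b (p - s)).
Proof.
by apply: (measurableT_comp (measurable_rpospow b)); exact: measurable_funB.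
Qed.

Lemma cmeasurable_pospow_sub z (p : R) : cmeasurable (fun s => pospow z (p - s)).
Proof.
have [mr mi] := cmeasurable_pospow z.
by split; [apply: (measurableT_comp mr)|apply: (measurableT_comp mi)];
  exact: measurable_funB.
Qed.

Lemma measurable_rbetaker a b : measurable_fun setT (rbetaker a b).
Proof.
by apply: measurable_funM; [exact: measurable_rpospow|exact: measurable_rpospow_sub].
Qed.

Lemma cmeasurable_betaker w z : cmeasurable (betaker w z).
Proof.
by apply: cmeasurableM; [exact: cmeasurable_pospow|exact: cmeasurable_pospow_sub].
Qed.

Lemma rbetaker_ge0 a b t : 0 <= rbetaker a b t.
Proof. by rewrite mulr_ge0 ?rpospow_ge0. Qed.

Lemma normc_betaker w z t :
  Normc.normc (betaker w z t) = rbetaker (complex.Re w) (complex.Re z) t.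
Proof. by rewrite Normc.normcM !normc_pospow. Qed.

(** The product of the kernels of Gamma(w) at [s] and of Gamma(z) at [p - s]: the
    double integral of Gamma(w) * Gamma(z) after the substitution p = s + t. *)
Definition gammaker2 w z (sp : R * R) : R[i] :=
  pospow w sp.1 * pospow z (sp.2 - sp.1) * (expR (- sp.2))%:C.

Definition rgammaker2 (a b : R) (sp : R * R) : R :=
  rpospow a sp.1 * rpospow b (sp.2 - sp.1) * expR (- sp.2).

Lemma normc_gammaker2 w z sp : Normc.normc (gammaker2 w z sp) =
  rgammaker2 (complex.Re w) (complex.Re z) sp.
Proof.
by rewrite !Normc.normcM !normc_pospow normc_real ger0_norm ?expR_ge0.
Qed.

Lemma measurable_rgammaker2 a b : measurable_fun setT (rgammaker2 a b).
Proof.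
apply: measurable_funM; first apply: measurable_funM.
- exact: (measurableT_comp (measurable_rpospow a) measurable_fst).
- apply: (measurableT_comp (measurable_rpospow b)).
  by apply: measurable_funB; [exact: measurable_snd|exact: measurable_fst].
- exact: (measurableT_comp measurable_expRN measurable_snd).
Qed.

Lemma cmeasurable_gammaker2 w z : cmeasurable (gammaker2 w z).
Proof.
apply: cmeasurableM; last first.
  apply: cmeasurable_real.
  exact: (measurableT_comp measurable_expRN measurable_snd).
have [wr wi] := cmeasurable_pospow w.
apply: cmeasurableM.
  by split; [exact: (measurableT_comp wr measurable_fst)|
    exact: (measurableT_comp wi measurable_fst)].
have [mr mi] := cmeasurable_pospow z.
by split; [apply: (measurableT_comp mr)|apply: (measurableT_comp mi)];
  apply: measurable_funB; [exact: measurable_snd|exact: measurable_fst|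
    exact: measurable_snd|exact: measurable_fst].
Qed.

Lemma rgammaker2_shift a b s p :
  rgammaker2 a b (s, p) = rgammaker a s * rgammaker b (1 * p + - s).
Proof.
rewrite /rgammaker2 /rgammaker /= mul1r (_ : - p = - s + - (p - s)); last by ring.
by rewrite expRD; ring.
Qed.

Lemma gammaker2_shift w z s p :
  gammaker2 w z (s, p) = gammaker w s * gammaker z (1 * p + - s).
Proof.
rewrite /gammaker2 /gammaker /= mul1r (_ : - p = - s + - (p - s)); last by ring.
by rewrite expRD rmorphM; ring.
Qed.

(** On the segment 0 < s < p, parametrised by s = p t, the kernel is homogeneous
    and splits into a function of [p] and the beta kernel. *)
Lemma rgammaker2_scale a b p t : 0 < p ->
  rgammaker2 a b (p * t + 0, p) =
  p^-1 * rgammaker (a + b) p * rbetaker a b t.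
Proof.
move=> p0; rewrite /rgammaker2 /rgammaker /rbetaker /= addr0.
have -> : p - p * t = p * (1 - t) by ring.
rewrite /rpospow p0 !pmulr_rgt0//; case: ifPn => t0; last by rewrite !mul0r mulr0.
case: ifPn => t1; last by rewrite !mulr0 mul0r.
rewrite !powRM ?(ltW p0) ?(ltW t0) ?(ltW t1)//.
have -> : p `^ (a + b - 1) = p * (p `^ (a - 1) * p `^ (b - 1)).
  rewrite -powRD ?(gt_eqF p0) ?implybT// -[X in X * _](powRr1 (ltW p0)).
  by rewrite -powRD ?(gt_eqF p0) ?implybT//; congr (_ `^ _); ring.
by field; rewrite gt_eqF.
Qed.

Lemma gammaker2_scale w z p t : 0 < p ->
  gammaker2 w z (p * t + 0, p) =
  (p^-1)%:C * gammaker (w + z) p * betaker w z t.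
Proof.
move=> p0; rewrite /gammaker2 /gammaker /betaker /= addr0.
have -> : p - p * t = p * (1 - t) by ring.
rewrite /pospow p0 !pmulr_rgt0//; case: ifPn => t0; last by rewrite !mul0r mulr0.
case: ifPn => t1; last by rewrite !mulr0 mul0r.
rewrite !cpowRM//.
have -> : cpowR p (w + z - 1) = p%:C * (cpowR p (w - 1) * cpowR p (z - 1)).
  by rewrite -cpowRD// -{1}(cpowR1 p0) -cpowRD//; congr (cpowR _ _); ring.
rewrite -[RHS]mulrA.
rewrite -!mulrA [RHS]mulrA -rmorphM mulVf ?gt_eqF// mul1r; ring.
Qed.

Lemma gammaker2_eq0 w z s p : p <= 0 -> gammaker2 w z (s, p) = 0.
Proof.
move=> p0; rewrite /gammaker2 /pospow /=; case: ifPn => s0; last by rewrite !mul0r.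
by case: ifPn => [ps|]; [exfalso; lra|rewrite mulr0 mul0r].
Qed.

Lemma rgammaker2_eq0 a b s p : p <= 0 -> rgammaker2 a b (s, p) = 0.
Proof.
move=> p0; rewrite /rgammaker2 /rpospow /=; case: ifPn => s0; last by rewrite !mul0r.
by case: ifPn => [ps|]; [exfalso; lra|rewrite mulr0 mul0r].
Qed.

Lemma gammaker_eq0 z p : p <= 0 -> gammaker z p = 0.
Proof. by move=> p0; rewrite /gammaker /pospow ltNge p0 mul0r. Qed.

Lemma rgammaker_eq0 (a p : R) : p <= 0 -> rgammaker a p = 0.
Proof. by move=> p0; rewrite /rgammaker /rpospow ltNge p0 mul0r. Qed.

Lemma rgammaker2_ge0 a b sp : 0 <= rgammaker2 a b sp.
Proof. by rewrite !mulr_ge0 ?rpospow_ge0 ?expR_ge0. Qed.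

Lemma integral12_rgammaker2 (a b : R) : 0 < a -> 0 < b ->
  (\int[mu]_s \int[mu]_p (rgammaker2 a b (s, p))%:E =
   (rGamma a * rGamma b)%:E)%E.
Proof.
move=> a0 b0.
under eq_integral => s _.
  under eq_integral do rewrite rgammaker2_shift EFinM.
  rewrite ge0_integralZl//=; last 3 first.
  - apply/measurable_EFinP; apply: (measurableT_comp (measurable_rgammaker b)).
    by apply: measurable_funD => //; exact: measurable_funM.
  - by move=> p _; rewrite lee_fin rgammaker_ge0.
  - by rewrite lee_fin rgammaker_ge0.
  rewrite (@ge0_integral_affine _ 1 (- s) (EFin \o rgammaker b))//=; last 2 first.
  - by apply/measurable_EFinP; exact: measurable_rgammaker.
  - by move=> p; rewrite lee_fin rgammaker_ge0.
  rewrite invr1 mul1e -EFin_rGamma//.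
  over.
rewrite ge0_integralZr//=; last 3 first.
- by apply/measurable_EFinP; exact: measurable_rgammaker.
- by move=> p _; rewrite lee_fin rgammaker_ge0.
- by rewrite lee_fin ltW ?rGamma_gt0.
by rewrite -EFin_rGamma// EFinM.
Qed.

Lemma integral21_rgammaker2 (a b : R) : 0 < a -> 0 < b ->
  (\int[mu]_p \int[mu]_s (rgammaker2 a b (s, p))%:E =
   (rGamma (a + b))%:E * \int[mu]_t (rbetaker a b t)%:E)%E.
Proof.
move=> a0 b0; rewrite EFin_rGamma ?addr_gt0//.
have B0 : (0 <= \int[mu]_t (rbetaker a b t)%:E)%E.
  by apply: integral_ge0 => t _; rewrite lee_fin rbetaker_ge0.
rewrite -ge0_integralZr//=; last 2 first.
- by apply/measurable_EFinP; exact: measurable_rgammaker.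
- by move=> p _; rewrite lee_fin rgammaker_ge0.
apply: eq_integral => p _.
have [p0|p0] := leP p 0.
  rewrite rgammaker_eq0// mul0e; under eq_integral do rewrite rgammaker2_eq0//.
  by rewrite integral0.
have pi0 : (0 <= (p^-1)%:E)%E by rewrite lee_fin invr_ge0 ltW.
have := @ge0_integral_affine _ p 0 (fun s => (rgammaker2 a b (s, p))%:E) p0.
move=> /(_ _ _)/esym E.
have {}E : ((p^-1)%:E * \int[mu]_s (rgammaker2 a b (s, p))%:E =
  (p^-1)%:E * ((rgammaker (a + b) p)%:E * \int[mu]_t (rbetaker a b t)%:E))%E.
  rewrite E; last 2 first.
  - apply/measurable_EFinP.
    exact: (measurableT_comp (measurable_rgammaker2 a b) (measurable_pair2 p)).
  - by move=> s; rewrite lee_fin rgammaker2_ge0.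
  under eq_integral do rewrite rgammaker2_scale// -mulrA EFinM.
  rewrite ge0_integralZl//=; last 2 first.
  - apply/measurable_EFinP; apply: measurable_funM => //.
    exact: measurable_rbetaker.
  - by move=> t _; rewrite lee_fin mulr_ge0 ?rgammaker_ge0 ?rbetaker_ge0.
  under eq_integral do rewrite EFinM.
  rewrite ge0_integralZl//=.
  - by apply/measurable_EFinP; exact: measurable_rbetaker.
  - by move=> t _; rewrite lee_fin rbetaker_ge0.
  - by rewrite lee_fin rgammaker_ge0.
have := congr1 (fun x => p%:E * x)%E E.
by rewrite !muleA -EFinM divff ?gt_eqF// !mul1e.
Qed.

(** Tonelli's theorem for [rgammaker2]: integrating first in [p] gives the product
    of the Gamma values, integrating first in [s] the right-hand side. *)
Lemma rGamma_rbeta (a b : R) : 0 < a -> 0 < b ->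
  ((rGamma a * rGamma b)%:E =
   (rGamma (a + b))%:E * \int[mu]_t (rbetaker a b t)%:E)%E.
Proof.
move=> a0 b0; rewrite -(integral12_rgammaker2 a0 b0) -(integral21_rgammaker2 a0 b0).
have mk : measurable_fun setT (EFin \o rgammaker2 a b).
  by apply/measurable_EFinP; exact: measurable_rgammaker2.
apply: (@fubini_tonelli _ _ (measurableTypeR R) (measurableTypeR R) R
  lebesgue_measure lebesgue_measure (EFin \o rgammaker2 a b) mk).
by move=> sp; rewrite lee_fin rgammaker2_ge0.
Qed.

Lemma integral_rbetaker (a b : R) : 0 < a -> 0 < b ->
  (\int[mu]_t (rbetaker a b t)%:E =
   (rGamma a * rGamma b / rGamma (a + b))%:E)%E.
Proof.
move=> a0 b0; have G0 : 0 < rGamma (a + b) by rewrite rGamma_gt0// addr_gt0.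
rewrite EFinM rGamma_rbeta// muleAC -EFinM divff ?gt_eqF// mul1e//.
Qed.

(** The modulus of the beta kernel is the beta kernel of the real parts, whose
    integral is finite by [rGamma_rbeta], as rGamma (a + b) > 0. *)
Lemma cintegrable_betaker w z : 0 < complex.Re w -> 0 < complex.Re z ->
  cintegrable mu setT (betaker w z).
Proof.
move=> w0 z0; apply/cintegrableP; split; first exact: cmeasurable_betaker.
under eq_integral do rewrite normc_betaker.
by rewrite integral_rbetaker// ltry.
Qed.

Lemma cintegral_gammaker2_right w z s : 0 < complex.Re z ->
  cintegral mu setT (fun p => gammaker2 w z (s, p)) =
  gammaker w s * Gamma_integral z.
Proof.
move=> z0; under eq_cintegral do rewrite gammaker2_shift.
have iz := cintegrable_gammaker z0.
rewrite cintegralZ; last exact: cintegrable_affine.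
by rewrite (cintegral_affine (- s) ltr01 iz) invr1 mul1r -Gamma_integralE.
Qed.

Lemma cintegral_gammaker2_left w z p : 0 < complex.Re w -> 0 < complex.Re z ->
  cintegral mu setT (fun s => gammaker2 w z (s, p)) =
  gammaker (w + z) p * cintegral mu setT (betaker w z).
Proof.
move=> w0 z0; have [p0|p0] := leP p 0.
  under eq_cintegral do rewrite gammaker2_eq0//.
  by rewrite cintegral0 gammaker_eq0// mul0r.
have ib := cintegrable_betaker w0 z0.
have E : cintegral mu setT (fun t => gammaker2 w z (p * t + 0, p)) =
    (p^-1)%:C * gammaker (w + z) p * cintegral mu setT (betaker w z).
  by under eq_cintegral do rewrite gammaker2_scale//; rewrite cintegralZ.
have ig : cintegrable mu setT (fun s => gammaker2 w z (s, p)).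
  rewrite (_ : (fun s => _) = (fun s =>
      ((p^-1)%:C * gammaker (w + z) p) * betaker w z (p^-1 * s + 0))).
    by apply: cintegrableZ; apply: cintegrable_affine; rewrite ?invr_gt0.
  by apply/funext => s; rewrite -gammaker2_scale// !addr0 mulrA divff ?gt_eqF// mul1r.
have /= := cintegral_affine 0 p0 ig; rewrite E -mulrA.
by move=> /mulfI <- //; rewrite -(rmorph0 (real_complex R)) (inj_eq (@complexI R)) invr_eq0 gt_eqF.
Qed.

(** Fubini's theorem for [gammaker2], as in [rGamma_rbeta]; integrability is the
    real case. *)
Lemma Gamma_integral_beta w z : 0 < complex.Re w -> 0 < complex.Re z ->
  Gamma_integral w * Gamma_integral z =
  Gamma_integral (w + z) * cintegral mu setT (betaker w z).
Proof.
move=> w0 z0.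
have ik : cintegrable (mu \x mu)%E setT (gammaker2 w z).
  apply: cintegrable_tonelli; first exact: cmeasurable_gammaker2.
  under eq_integral do under eq_integral do rewrite normc_gammaker2.
  by rewrite integral12_rgammaker2// ltry.
have := cintegral12_prod ik; rewrite -(cintegral21_prod ik).
under eq_cintegral do rewrite cintegral_gammaker2_right// mulrC.
under [RHS]eq_cintegral do rewrite cintegral_gammaker2_left// mulrC.
rewrite !cintegralZ; last 2 first.
- by apply: cintegrable_gammaker; case: w w0 z z0 {ik} => [a b] /= ? [c e] /= ?; rewrite addr_gt0.
- exact: cintegrable_gammaker.
by rewrite -!Gamma_integralE mulrC => ->; rewrite mulrC.
Qed.

End beta_integral.

(** * The functional equation and a lower bound on the modulus of Gamma *)

Section functional_equation.
Context {R : realType}.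
Local Notation mu := (@lebesgue_measure R).
Variables (a b : R).
Hypothesis a_gt0 : 0 < a.

Let arg (c t : R) : R := b * ln t + c.

(** With z = a + i b, this is the real part of t^z e^(-t) for the phase [c = 0], and
    its imaginary part for [c = - (pi / 2)]. *)
Definition gamma_prim (c t : R) : R := t `^ a * cos (arg c t) * expR (- t).

Definition gamma_deriv (c t : R) : R :=
  (a * (t `^ (a - 1) * cos (arg c t)) - b * (t `^ (a - 1) * sin (arg c t)))
    * expR (- t) - t `^ a * cos (arg c t) * expR (- t).

Let is_derive_arg (c t : R) : 0 < t -> is_derive t 1 (arg c) (b * t^-1).
Proof.
move=> t0; have dl := is_derive1_ln t0.
have d := is_deriveD (is_deriveZ b dl) (is_derive_cst c t 1).
by apply: (@is_derive_eq _ _ _ (arg c) _ _ _ _ d); rewrite addr0.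
Qed.

Let is_derive_cosarg (c t : R) : 0 < t ->
  is_derive t 1 (fun t => cos (arg c t)) (- sin (arg c t) * (b * t^-1)).
Proof.
by move=> t0; apply: is_derive1_comp (is_derive_cos _) (is_derive_arg c t0).
Qed.

Let is_derive_sinarg (c t : R) : 0 < t ->
  is_derive t 1 (fun t => sin (arg c t)) (cos (arg c t) * (b * t^-1)).
Proof.
by move=> t0; apply: is_derive1_comp (is_derive_sin _) (is_derive_arg c t0).
Qed.

Let is_derive_expRN (t : R) : is_derive t 1 (fun t => expR (- t)) (- expR (- t)).
Proof.
have d := is_derive1_comp (is_derive_expR (- t)) (is_deriveN (is_derive_id t 1)).
by apply: (@is_derive_eq _ _ _ (fun t => expR (- t)) _ _ _ _ d); rewrite mulrN1.
Qed.

Let derive_continuous (f : R -> R) (t l : R) :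
  is_derive t 1 f l -> {for t, continuous f}.
Proof.
by move=> d; apply/differentiable_continuous/derivable1_diffP; case: d.
Qed.

Lemma is_derive_gamma_prim (c t : R) : 0 < t ->
  is_derive t 1 (gamma_prim c) (gamma_deriv c t).
Proof.
move=> t0; have dp := is_derive1_powR a t0.
have d := is_deriveM (is_deriveM dp (is_derive_cosarg c t0)) (is_derive_expRN t).
apply: (@is_derive_eq _ _ _ (gamma_prim c) _ _ _ _ d).
rewrite /gamma_deriv mulrfctE /GRing.scale/=.
have -> : t `^ a = t * t `^ (a - 1) by rewrite mulr_powRB1// ltW.
by field; rewrite gt_eqF.
Qed.

Lemma continuous_gamma_deriv (c t : R) : 0 < t ->
  {for t, continuous (gamma_deriv c)}.
Proof.
move=> t0.
have cp u : {for t, continuous (fun t : R => t `^ u)} by exact: continuous_powRl.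
have cc := derive_continuous (is_derive_cosarg c t0).
have cs := derive_continuous (is_derive_sinarg c t0).
have ce := derive_continuous (is_derive_expRN t).
apply: cvgB; last by apply: cvgM => //; apply: cvgM => //; exact: cp.
apply: cvgM => //; apply: cvgB; apply: cvgM; do ?exact: cvg_cst.
  by apply: cvgM => //; exact: cp.
by apply: cvgM => //; exact: cp.
Qed.

Lemma normr_gamma_prim_le (c t : R) : `|gamma_prim c t| <= t `^ a * expR (- t).
Proof.
rewrite !normrM (ger0_norm (powR_ge0 _ _)) (ger0_norm (expR_ge0 _)).
by rewrite ler_wpM2r ?expR_ge0// ler_piMr ?powR_ge0// cos_max.
Qed.

Lemma cvg_gamma_prim0 (c : R) : gamma_prim c n.+1%:R^-1 @[n --> \oo] --> 0.
Proof.
apply/norm_cvg0P.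
apply: (@squeeze_cvgr _ _ _ _ (cst 0) (fun n => (n.+1%:R^-1) `^ a)).
- apply: nearW => n /=; rewrite normr_ge0/=.
  rewrite (le_trans (normr_gamma_prim_le _ _))// ler_piMr ?powR_ge0//.
- exact: cvg_cst.
- have /cvg_at_rightP := powR_cvg0 a_gt0; apply; split.
    by move=> n; rewrite invr_gt0.
  exact: cvg_harmonic.
Qed.

Lemma cvg_gamma_primy (c : R) : gamma_prim c n.+2%:R @[n --> \oo] --> 0.
Proof.
have [C C0 CE] := expR_ge_powR (ltW a_gt0).
apply/norm_cvg0P.
apply: (@squeeze_cvgr _ _ _ _ (cst 0) (fun n => 2 * C * harmonic n)).
- apply: nearW => n /=; rewrite normr_ge0/=.
  rewrite (le_trans (normr_gamma_prim_le _ _))//.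
  set t : R := n.+2%:R; have t0 : 0 < t by rewrite ltr0n.
  have := CE t t0; have := @expR_ge1Dx R (t / 2) => h1 h2.
  have e0 := expR_gt0 (t / 2).
  have -> : expR (- t) = (expR (t / 2))^-1 * (expR (t / 2))^-1.
    by rewrite -expRN -expRD; congr expR; field.
  apply: (@le_trans _ _ (C * (expR (t / 2))^-1)).
    rewrite mulrA ler_wpM2r ?invr_ge0 ?(ltW e0)// ler_pdivrMr//.
    by apply: le_trans h2; rewrite lerDr.
  rewrite [2 * C]mulrC -mulrA ler_wpM2l ?(ltW C0)// /harmonic.
  have n0 : (0 : R) < n.+1%:R by rewrite ltr0n.
  rewrite -[leRHS]invrK lef_pV2 ?posrE ?invr_gt0 ?mulr_gt0 ?invr_gt0//.
  have tE : t = n.+1%:R + 1 by rewrite natr1.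
  apply: le_trans h1; rewrite invfM invrK tE; lra.
- exact: cvg_cst.
- by rewrite -[X in _ --> X](mulr0 (2 * C)); apply: cvgMr; exact: cvg_harmonic.
Qed.

(** The primitive tends to 0 at both ends of the half-line. *)
Lemma Rintegral_gamma_deriv (c : R) (g : R -> R) :
  mu.-integrable setT (EFin \o g) ->
  (forall t, g t = if 0 < t then gamma_deriv c t else 0) ->
  \int[mu]_t g t = 0.
Proof.
move=> ig gE.
have gE' : g = (gamma_deriv c) \_ `]0, +oo[.
  apply/funext => t; rewrite gE patchE mem_setE in_itv/= andbT.
  by case: ifP.
rewrite gE' -Rintegral_mkcond.
apply: (@integral_FTC_lim _ (gamma_prim c)).
- by move=> t t0; exact: is_derive_gamma_prim.
- by move=> t t0; exact: continuous_gamma_deriv.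
- apply/integrable_mkcond => //; apply: eq_integrable ig => // t _.
  by rewrite /= gE' !patchE; case: ifP.
- rewrite -[X in _ --> X](subr0 0); apply: cvgB.
    exact: cvg_gamma_primy.
  exact: cvg_gamma_prim0.
Qed.

End functional_equation.

Section gamma_bounds.
Context {R : realType}.
Local Notation mu := (@lebesgue_measure R).
Implicit Types (t u v : R) (z w : R[i]).

(** The derivative z t^(z-1) e^(-t) - t^z e^(-t) of t^z e^(-t) has integral 0. *)
Lemma Gamma_integralS z : 0 < complex.Re z ->
  Gamma_integral (z + 1) = z * Gamma_integral z.
Proof.
case: z => a b /= a0; set z : R[i] := a +i* b.
have z1 : 0 < complex.Re (z + 1) by rewrite ReD/= addr_gt0.
pose h t := z * gammaker z t + (-1) * gammaker (z + 1) t.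
have i1 : cintegrable mu setT (fun t => z * gammaker z t).
  by apply: cintegrableZ; exact: cintegrable_gammaker.
have i2 : cintegrable mu setT (fun t => (-1) * gammaker (z + 1) t).
  by apply: cintegrableZ; exact: cintegrable_gammaker.
have ih : cintegrable mu setT h by exact: cintegrableD.
have hE : cintegral mu setT h = z * Gamma_integral z - Gamma_integral (z + 1).
  rewrite cintegralD// !cintegralZ; [|exact: cintegrable_gammaker..].
  by rewrite -!Gamma_integralE mulN1r.
have re_h t : complex.Re (h t) = if 0 < t then gamma_deriv a b 0 t else 0.
  rewrite /h /gammaker /pospow; case: ifP => t0; last by rewrite !mul0r !mulr0 addr0.
  rewrite addrK /gamma_deriv ReD !ReM !ImM /cpowR /= ?oppr0 !addr0; ring.
have im_h t : complex.Im (h t) =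
    if 0 < t then gamma_deriv a b (- (pi / 2)) t else 0.
  rewrite /h /gammaker /pospow; case: ifP => t0; last by rewrite !mul0r !mulr0 addr0.
  rewrite addrK /gamma_deriv ImD !ImM !ReM /cpowR /= !cosBpihalf !sinBpihalf.
  rewrite ?oppr0 !addr0; ring.
have : cintegral mu setT h = 0.
  apply: complex_eqP; rewrite /cintegral/=.
    by apply: (Rintegral_gamma_deriv a0 _ re_h); exact: ih.1.
  by apply: (Rintegral_gamma_deriv a0 _ im_h); exact: ih.2.
by rewrite hE => /eqP; rewrite subr_eq0 => /eqP.
Qed.

Lemma rGammaS u : 0 < u -> rGamma (u + 1) = u * rGamma u.
Proof.
move=> u0.
suff h : (rGamma (u + 1))%:C = (u * rGamma u)%:C :> R[i] by exact: complexI h.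
rewrite (rmorphM (real_complex R)) -!Gamma_integral_real.
by rewrite (rmorphD (real_complex R)) (rmorph1 (real_complex R)) Gamma_integralS//
  Gamma_integral_real.
Qed.

Lemma normr_sin_le (t : R) : `|sin t| <= `|t|.
Proof.
wlog t0 : t / 0 < t => [h|].
  have [t0|t0|->] := ltgtP t 0; last 2 first.
  - exact: h.
  - by rewrite sin0.
  by rewrite -normrN -sinN -[leRHS]normrN h// oppr_gt0.
have [|c _] := MVT t0 (fun x _ => is_derive_sin x).
  by apply: continuous_subspaceT; exact: continuous_sin.
by rewrite sin0 !subr0 => ->; rewrite normrM ler_piMl// cos_max.
Qed.

Lemma cos_ge (t : R) : 1 - t ^+ 2 / 2 <= cos t.
Proof.
have -> : t = (t / 2) *+ 2 by rewrite -mulr_natr; field.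
rewrite cos_mulr2n cos2sin2 -mulr_natr.
have : sin (t / 2) ^+ 2 <= (t / 2) ^+ 2.
  by rewrite -[leLHS]real_normK ?num_real// -[leRHS]real_normK ?num_real//
    ler_sqr ?nnegrE// normr_sin_le.
set s := sin _ ^+ 2; rewrite exprMn -mulr_natr; nra.
Qed.

(** With s the square root of r, the bounds 1 - 1/s <= ln s <= s - 1 give
    |ln s| <= |s - 1/s|. The right-hand side is chosen because the means of t and
    1/t under the gamma density are explicit. *)
Lemma ln_sqr_le (r : R) : 0 < r -> ln r ^+ 2 <= 4 * (r - 2 + r^-1).
Proof.
move=> r0; pose s := Num.sqrt r.
have s0 : 0 < s by rewrite sqrtr_gt0.
have rE : r = s * s by rewrite -expr2 sqr_sqrtr// ltW.
have l1 : ln s <= s - 1.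
  by rewrite -{1}[s](subrK 1) addrC le_ln1Dx//; lra.
have l2 : - ln s <= s^-1 - 1.
  rewrite -lnV ?posrE// -{1}[s^-1](subrK 1) addrC le_ln1Dx//.
  by rewrite ltrBDl subrr invr_gt0.
have sV : s * s^-1 = 1 by rewrite divff ?gt_eqF.
have sV0 : 0 < s^-1 by rewrite invr_gt0.
rewrite rE lnM ?posrE// invfM.
have : `|ln s| <= `|s - s^-1|.
  have [s1|s1] := leP 1 s.
    have i1 : s^-1 <= 1 by rewrite invf_le1.
    by rewrite !ger0_norm ?ln_ge0 ?subr_ge0//; lra.
  have i1 : 1 <= s^-1 by rewrite invf_ge1// ltW.
  by rewrite !ler0_norm ?ln_le0 ?subr_le0 ?(ltW s1)//; lra.
move=> h; have : ln s ^+ 2 <= (s - s^-1) ^+ 2.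
  by rewrite -[leLHS]real_normK ?num_real// -[leRHS]real_normK ?num_real//
    ler_sqr ?nnegrE.
have -> : (s - s^-1) ^+ 2 = s * s - 2 + s^-1 * s^-1.
  by rewrite sqrrB -!expr2 sV.
have -> : (ln s + ln s) ^+ 2 = 4 * ln s ^+ 2 by ring.
lra.
Qed.

Lemma integral_rgammaker_mul u : 0 < u ->
  (\int[mu]_t (rgammaker u t * t)%:E = (u * rGamma u)%:E)%E.
Proof.
move=> u0; rewrite -rGammaS// EFin_rGamma ?addr_gt0//.
apply: eq_integral => t _; rewrite /rgammaker /rpospow addrK.
case: ifPn => t0; last by rewrite !mul0r.
by rewrite mulrAC [_ * t]mulrC mulr_powRB1// ltW.
Qed.

Lemma integral_rgammaker_div u : 1 < u ->
  (\int[mu]_t (rgammaker u t * t^-1)%:E = (rGamma u / (u - 1))%:E)%E.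
Proof.
move=> u1; have u10 : 0 < u - 1 by rewrite subr_gt0.
have -> : rGamma u / (u - 1) = rGamma (u - 1).
  by rewrite -{1}[u](subrK 1) rGammaS// mulrAC divff ?mul1r// gt_eqF.
rewrite EFin_rGamma//.
apply: eq_integral => t _; rewrite /rgammaker /rpospow.
case: ifPn => t0; last by rewrite !mul0r.
rewrite mulrAC -{1}(mulr_powRB1 (ltW t0) u10); congr (_ * _)%:E.
by rewrite mulrAC divff ?mul1r// gt_eqF.
Qed.

(** The modulus of Gamma(u + iv) is at least the real part of
    u^(-iv) Gamma(u + iv), which is the integral of cos (v ln (t / u)) against the
    density t^(u-1) e^(-t). This density concentrates around t = u, so the cosine
    is close to 1 on average; [cos_ge] and [ln_sqr_le] reduce the estimate to the
    means of t and 1/t. *)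
Lemma normc_Gamma_integral_ge (u v : R) : 1 < u ->
  (1 - 2 * v ^+ 2 / (u - 1)) * rGamma u <=
  Normc.normc (Gamma_integral (u +i* v)).
Proof.
move=> u1; have u0 : 0 < u by exact: lt_trans u1.
have u10 : 0 < u - 1 by rewrite subr_gt0.
set z := u +i* v.
have iz : cintegrable mu setT (gammaker z) by exact: cintegrable_gammaker.
pose e : R[i] := cpowR u (0 +i* (- v)).
have ne : Normc.normc e = 1 by rewrite normc_cpowR /= powRr0.
rewrite -[leRHS]mul1r -[X in _ <= X * _]ne -Normc.normcM Gamma_integralE -cintegralZ//.
apply: le_trans (normr_Re_le _); apply: le_trans (ler_norm _).
rewrite /cintegral/=.
have [ir _] := cintegrableZ e iz.
have irg : mu.-integrable setT (EFin \o rgammaker u).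
  apply/integrableP; split.
    by apply/measurable_EFinP; exact: measurable_rgammaker.
  under eq_integral do rewrite /= ger0_norm ?rgammaker_ge0//.
  exact: integral_rgammaker_lty.
have irm : mu.-integrable setT (EFin \o (fun t => rgammaker u t * t)).
  apply/integrableP; split.
    by apply/measurable_EFinP; apply: measurable_funM => //; exact: measurable_rgammaker.
  rewrite (_ : \int[mu]_t _ = \int[mu]_t (rgammaker u t * t)%:E)%E.
    by rewrite integral_rgammaker_mul// ltry.
  apply: eq_integral => t _; rewrite /= ger0_norm//.
  by rewrite /rgammaker /rpospow; case: ifP => t0; rewrite ?mul0r// !mulr_ge0 ?powR_ge0 ?expR_ge0 ?ltW.
have ird : mu.-integrable setT (EFin \o (fun t => rgammaker u t * t^-1)).
  rewrite (_ : _ \o _ = EFin \o rgammaker (u - 1)).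
    apply/integrableP; split.
      by apply/measurable_EFinP; exact: measurable_rgammaker.
    under eq_integral do rewrite /= ger0_norm ?rgammaker_ge0//.
    exact: integral_rgammaker_lty.
  apply/funext => t; rewrite /= /rgammaker /rpospow.
  case: ifPn => t0; last by rewrite !mul0r.
  rewrite mulrAC -{1}(mulr_powRB1 (ltW t0) u10); congr (_ * _)%:E.
  by rewrite mulrAC divff ?mul1r// gt_eqF.
pose k := 2 * v ^+ 2.
(* cos x >= 1 - x^2 / 2 at x = v ln (t / u), with (ln r)^2 <= 4 (r - 2 + 1/r) *)
pose low t := (1 + 2 * k) * rgammaker u t +
  (- (k / u)) * (rgammaker u t * t) + (- (k * u)) * (rgammaker u t * t^-1).
have i1 : mu.-integrable setT (EFin \o (fun t => (1 + 2 * k) * rgammaker u t)).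
  by rewrite /comp; under eq_fun do rewrite EFinM; exact: integrableZl.
have i2 : mu.-integrable setT (EFin \o (fun t => (- (k / u)) * (rgammaker u t * t))).
  by rewrite /comp; under eq_fun do rewrite EFinM; exact: integrableZl.
have i3 : mu.-integrable setT (EFin \o (fun t => (- (k * u)) * (rgammaker u t * t^-1))).
  by rewrite /comp; under eq_fun do rewrite EFinM; exact: integrableZl.
have i12 : mu.-integrable setT (EFin \o
    (fun t => (1 + 2 * k) * rgammaker u t + (- (k / u)) * (rgammaker u t * t))).
  by rewrite /comp; under eq_fun do rewrite EFinD; exact: integrableD.
have il : mu.-integrable setT (EFin \o low).
  by rewrite /comp /low; under eq_fun do rewrite EFinD; exact: integrableD.
have -> : (1 - 2 * v ^+ 2 / (u - 1)) * rGamma u = \int[mu]_t low t.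
  rewrite /low RintegralD// RintegralD// !RintegralZl//.
  rewrite {2}/Rintegral integral_rgammaker_mul//.
  rewrite {2}/Rintegral integral_rgammaker_div//= -/(rGamma u) -/k.
  by field; rewrite !gt_eqF.
apply: le_Rintegral => // t _.
have -> : complex.Re (e * gammaker z t) =
    rgammaker u t * cos (v * (ln t - ln u)).
  rewrite /gammaker /rgammaker /pospow /rpospow; case: ifP => t0; last by rewrite !mul0r mulr0.
  rewrite mulrBr cosB ReM ReM ImM /e /cpowR /= powRr0 subr0 mulNr cosN sinN; ring.
have [t0|t0] := leP t 0.
  by rewrite /low rgammaker_eq0// !mul0r !mulr0 !addr0.
have -> : low t = rgammaker u t * (1 - k * (t / u - 2 + (t / u)^-1)).
  by rewrite /low; field; rewrite !gt_eqF.
apply: ler_wpM2l; first exact: rgammaker_ge0.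
apply: le_trans (cos_ge _).
have := @ln_sqr_le (t / u) (divr_gt0 t0 u0).
rewrite ln_div ?posrE// => h; rewrite lerD2l lerN2 exprMn /k.
have : v ^+ 2 * (ln t - ln u) ^+ 2 <= v ^+ 2 * (4 * (t / u - 2 + (t / u)^-1)).
  by rewrite ler_wpM2l// sqr_ge0.
lra.
Qed.

(** The lower bound [normc_Gamma_integral_ge] in the range where its factor is at
    least 1/2. *)
Lemma rGamma_le_normc z : 1 + 4 * complex.Im z ^+ 2 < complex.Re z ->
  rGamma (complex.Re z) <= 2 * Normc.normc (Gamma_integral z).
Proof.
set u := complex.Re z; set v := complex.Im z => uv; have v2 := sqr_ge0 v.
have zE : z = u +i* v by rewrite /u /v; case: z {u v uv v2}.
have u1 : 1 < u by lra.
have := @normc_Gamma_integral_ge u v u1; rewrite -zE.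
set N := Normc.normc _ => h.
have : 2 * v ^+ 2 / (u - 1) <= 2^-1.
  by rewrite ler_pdivrMr; lra.
have := @rGamma_gt0 R u (lt_trans ltr01 u1).
set g := rGamma u in h *; nra.
Qed.

Lemma natr_realC (n : nat) : n%:R = (n%:R)%:C :> R[i].
Proof. by rewrite (rmorph_nat (real_complex R)). Qed.

Lemma Gamma_integralD_nat z (n : nat) : 0 < complex.Re z ->
  Gamma_integral z = 0 -> Gamma_integral (z + n%:R) = 0.
Proof.
move=> z0 G0; elim: n => [|n IH]; first by rewrite addr0.
rewrite -natr1 addrA Gamma_integralS ?IH ?mulr0//.
by rewrite ReD natr_realC/= ltr_wpDr.
Qed.

(** By the functional equation a zero at z would be a zero at every z + n, which
    [rGamma_le_normc] excludes once n is large. *)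
Lemma Gamma_integral_neq0 z : 0 < complex.Re z -> Gamma_integral z != 0.
Proof.
move=> z0; apply/eqP => G0.
pose n := (Num.truncn (1 + 4 * complex.Im z ^+ 2)).+1.
have := @rGamma_le_normc (z + n%:R).
rewrite Gamma_integralD_nat// Normc.normc0 mulr0 ReD ImD natr_realC/= addr0.
have n1 : 1 + 4 * complex.Im z ^+ 2 < n%:R by exact: truncnS_gt.
have n2 : 1 + 4 * complex.Im z ^+ 2 < complex.Re z + n%:R.
  by rewrite (lt_trans n1)// ltrDr.
by move=> /(_ n2); rewrite leNgt rGamma_gt0// addr_gt0// ltr0n.
Qed.

(** The ratio Gamma(Re w) / |Gamma(w)| along w = z + al m is at most 2 for large m;
    the finitely many other values are added to the constant. *)
Lemma rGamma_ratio_bounded z (al : R) : 0 < complex.Re z -> 0 < al ->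
  exists2 K, 0 < K & forall m : nat,
    rGamma (complex.Re z + al * m%:R) <=
    K * Normc.normc (Gamma_integral (z + (al * m%:R)%:C)).
Proof.
move=> z0 al0.
pose x m := z + (al * m%:R)%:C.
have xr m : complex.Re (x m) = complex.Re z + al * m%:R by rewrite ReD.
have xi m : complex.Im (x m) = complex.Im z by rewrite ImD/= addr0.
have x0 m : 0 < complex.Re (x m) by rewrite xr ltr_wpDr// mulr_ge0// ltW.
pose q m := rGamma (complex.Re (x m)) / Normc.normc (Gamma_integral (x m)).
have n0 m : 0 < Normc.normc (Gamma_integral (x m)).
  by rewrite lt_neqAle normc_ge0 eq_sym normc_eq0 Gamma_integral_neq0.
have q0 m : 0 <= q m by rewrite divr_ge0 ?normc_ge0// ltW ?rGamma_gt0.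
pose M := (Num.truncn ((1 + 4 * complex.Im z ^+ 2) / al)).+1.
exists (2 + \sum_(m < M) q m) => [|m].
  by rewrite ltr_wpDr// sumr_ge0.
rewrite -xr -/(x m) -ler_pdivrMr// -/(q m).
have [mM|Mm] := ltnP m M.
  rewrite (bigD1 (Ordinal mM))//= addrCA lerDl addr_ge0// sumr_ge0//.
rewrite (@le_trans _ _ 2) ?lerDl ?sumr_ge0// /q ler_pdivrMr//.
apply: rGamma_le_normc; rewrite xi xr.
have : (1 + 4 * complex.Im z ^+ 2) / al < m%:R.
  by rewrite (lt_le_trans (truncnS_gt _))// ler_nat.
rewrite ltr_pdivrMr// mulrC => h; lra.
Qed.

(** For 0 < Re z no step of the continuation is taken. *)
Lemma Gamma_pos z : 0 < complex.Re z -> Gamma z = Gamma_integral z.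
Proof.
move=> z0; rewrite /Gamma (_ : Num.truncn _ = 0%N).
  by rewrite big_ord0 divr1 addr0.
by apply/eqP; rewrite -leqn0 truncn_le_nat; lra.
Qed.

End gamma_bounds.

(** * Beta kernels against a double series *)

Section beta_series.
Context {R : realType}.
Local Notation mu := (@lebesgue_measure R).
Implicit Types (t : R) (z w : R[i]).

Lemma Re_add_real z (r : R) : complex.Re (z + r%:C) = complex.Re z + r.
Proof. by rewrite ReD. Qed.

Lemma betaker_indic w z t : betaker w z t =
  if t \in `]0, 1[ then cpowR t (w - 1) * cpowR (1 - t) (z - 1) else 0.
Proof.
rewrite /betaker /pospow in_itv/= subr_gt0.
by case: (0 < t) => /=; [case: ifP => // _; rewrite mulr0|rewrite mul0r].
Qed.

Lemma betaker_powR w z (al : R) (m : nat) t :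
  betaker (w + (al * m%:R)%:C) z t = betaker w z t * (t `^ al)%:C ^+ m.
Proof.
rewrite /betaker /pospow mulrAC; case: ifP => t0; last by rewrite !mul0r.
congr (_ * _).
rewrite addrAC (@cpowRD _ t (w - 1))// cpowR_real -(rmorphXn (real_complex R)).
congr (_ * _%:C).
by rewrite powRrM powR_mulrn ?powR_ge0.
Qed.

Lemma Gamma_beta_quotient w z : 0 < complex.Re w -> 0 < complex.Re z ->
  cintegral mu setT (betaker w z) / Gamma w = Gamma z / Gamma (w + z).
Proof.
move=> w0 z0; have wz0 : 0 < complex.Re (w + z) by rewrite ReD addr_gt0.
rewrite !Gamma_pos//; apply/eqP.
rewrite eqr_div ?Gamma_integral_neq0//.
by rewrite [X in _ == X]mulrC Gamma_integral_beta// mulrC.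
Qed.

(** The integral is the real beta value at (Re w + al m, Re z). In its quotient of
    Gamma functions, [rGamma_ratio_bounded] puts the modulus of Gamma in the
    numerator, and |Gamma| <= Gamma(Re) does so in the denominator. *)
Lemma beta_norm_bound w z (al : R) : 0 < al ->
  0 < complex.Re w -> 0 < complex.Re z ->
  exists2 K, 0 < K & forall m : nat,
    (\int[mu]_t (Normc.normc (betaker (w + (al * m%:R)%:C) z t))%:E <=
     (K * Normc.normc (Gamma (w + (al * m%:R)%:C)) /
      Normc.normc (Gamma (w + z + (al * m%:R)%:C)))%:E)%E.
Proof.
move=> al0 w0 z0; have [K K0 KP] := rGamma_ratio_bounded w0 al0.
have gz0 := rGamma_gt0 z0.
exists (K * rGamma (complex.Re z)) => [|m]; first exact: mulr_gt0.
have am0 : 0 <= al * m%:R by rewrite mulr_ge0// ltW.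
have wm0 : 0 < complex.Re (w + (al * m%:R)%:C) by rewrite Re_add_real ltr_wpDr.
have wzm0 : 0 < complex.Re (w + z + (al * m%:R)%:C).
  by rewrite Re_add_real ltr_wpDr// ReD addr_gt0.
under eq_integral do rewrite normc_betaker.
rewrite integral_rbetaker// lee_fin !Gamma_pos//.
have n0 : 0 < Normc.normc (Gamma_integral (w + z + (al * m%:R)%:C)).
  by rewrite lt_neqAle normc_ge0 eq_sym normc_eq0 Gamma_integral_neq0.
have -> : complex.Re (w + (al * m%:R)%:C) + complex.Re z =
    complex.Re (w + z + (al * m%:R)%:C) by rewrite !Re_add_real ReD addrAC.
apply: ler_pM.
- by rewrite mulr_ge0// ltW// rGamma_gt0.
- by rewrite invr_ge0 ltW// rGamma_gt0.
- rewrite mulrAC ler_wpM2r ?(ltW gz0)//; rewrite Re_add_real; exact: KP.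
- by rewrite lef_pV2 ?posrE ?rGamma_gt0// normc_Gamma_integral_le.
Qed.

Definition beta2 w1 z1 w2 z2 (p : R * R) : R[i] :=
  betaker w1 z1 p.1 * betaker w2 z2 p.2.

Lemma beta2_eq0 w1 z1 w2 z2 p :
  p \notin (`]0, 1[ `*` `]0, 1[ : set (R * R)) -> beta2 w1 z1 w2 z2 p = 0.
Proof.
case: p => s t; rewrite notin_setE /beta2 !betaker_indic /=.
case: ifP => hs; last by rewrite mul0r.
by case: ifP => ht h; rewrite ?mulr0//; case: h.
Qed.

Lemma integral_normc_beta2 w1 z1 w2 z2 : 0 < complex.Re w1 -> 0 < complex.Re z1 ->
  0 < complex.Re w2 -> 0 < complex.Re z2 ->
  (\int[(mu \x mu)%E]_p (Normc.normc (beta2 w1 z1 w2 z2 p))%:E =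
   \int[mu]_s (Normc.normc (betaker w1 z1 s))%:E *
   \int[mu]_t (Normc.normc (betaker w2 z2 t))%:E)%E.
Proof.
move=> w10 z10 w20 z20.
have /cintegrableP[mb _] := cintegrable_tensor (cintegrable_betaker w10 z10)
  (cintegrable_betaker w20 z20).
have mn : measurable_fun setT (fun p => (Normc.normc (beta2 w1 z1 w2 z2 p))%:E).
  by apply/measurable_EFinP; exact: measurable_normc.
rewrite (@fubini_tonelli1 _ _ (measurableTypeR R) (measurableTypeR R) R
  lebesgue_measure lebesgue_measure
  (fun p => (Normc.normc (beta2 w1 z1 w2 z2 p))%:E) mn); last by move=> p; rewrite lee_fin normc_ge0.
rewrite /fubini_F.
under eq_integral do under eq_integral do rewrite /beta2 /= Normc.normcM.
rewrite integral_tensor//.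
- by apply: measurable_normc; exact: cmeasurable_betaker.
- by apply: measurable_normc; exact: cmeasurable_betaker.
- by move=> s; exact: normc_ge0.
- by move=> s; exact: normc_ge0.
Qed.

(** The terms of the left-hand series, multiplied by the kernel, are themselves
    products of beta kernels with shifted first parameters. Each integrates to
    Gamma z1 * Gamma z2 times a term of [V], and by [beta_norm_bound] the integrals
    of the moduli are dominated by the moduli of the terms of [V]: the termwise
    integration theorem applies. *)
Lemma cintegral_beta2_dseries (w1 z1 w2 z2 : R[i]) (al be : R)
    (c : nat -> nat -> R[i]) :
  0 < al -> 0 < be ->
  0 < complex.Re w1 -> 0 < complex.Re z1 ->
  0 < complex.Re w2 -> 0 < complex.Re z2 ->
  let W1 m := w1 + (al * m%:R)%:C in let W2 n := w2 + (be * n%:R)%:C in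
  let U m n := c m n / (Gamma (W1 m) * Gamma (W2 n)) in
  let V m n := c m n /
    (Gamma (w1 + z1 + (al * m%:R)%:C) * Gamma (w2 + z2 + (be * n%:R)%:C)) in
  let u p m n := U m n * ((p.1 `^ al)%:C ^+ m * (p.2 `^ be)%:C ^+ n) in
  (forall p, p \in (`]0, 1[ `*` `]0, 1[ : set (R * R)) -> sq_bounded (u p)) ->
  sq_bounded V ->
  cintegrable (mu \x mu)%E setT
    (fun p => beta2 w1 z1 w2 z2 p * dseries (u p)) /\
  cintegral (mu \x mu)%E setT
    (fun p => beta2 w1 z1 w2 z2 p * dseries (u p)) =
  Gamma z1 * Gamma z2 * dseries V.
Proof.
move=> al0 be0 w10 z10 w20 z20 W1 W2 U V u uB VB.
have W10 m : 0 < complex.Re (W1 m).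
  by rewrite Re_add_real ltr_wpDr// mulr_ge0// ltW.
have W20 n : 0 < complex.Re (W2 n).
  by rewrite Re_add_real ltr_wpDr// mulr_ge0// ltW.
have G1 m : Gamma (W1 m) != 0 by rewrite Gamma_pos// Gamma_integral_neq0.
have G2 n : Gamma (W2 n) != 0 by rewrite Gamma_pos// Gamma_integral_neq0.
pose f m n p := U m n * beta2 (W1 m) z1 (W2 n) z2 p.
have fE p m n : f m n p = beta2 w1 z1 w2 z2 p * u p m n.
  by rewrite /f /u /beta2 !betaker_powR; ring.
have ib m n : cintegrable (mu \x mu)%E setT (beta2 (W1 m) z1 (W2 n) z2).
  by apply: cintegrable_tensor; exact: cintegrable_betaker.
have [K1 K10 K1P] := beta_norm_bound al0 w10 z10.
have [K2 K20 K2P] := beta_norm_bound be0 w20 z20.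
have [B VB'] := VB.
pose M m n := K1 * K2 * Normc.normc (V m n).
have mf m n : cmeasurable (f m n).
  by have /cintegrableP[] := cintegrableZ (U m n) (ib m n).
have fM m n :
    (\int[(mu \x mu)%E]_p (Normc.normc (f m n p))%:E <= (M m n)%:E)%E.
  under eq_integral do rewrite Normc.normcM EFinM.
  rewrite ge0_integralZl//=; last 3 first.
  - by apply/measurable_EFinP/measurable_normc; have /cintegrableP[] := ib m n.
  - by move=> p _; rewrite lee_fin normc_ge0.
  - by rewrite lee_fin normc_ge0.
  rewrite integral_normc_beta2//.
  apply: (@le_trans _ _ ((Normc.normc (U m n))%:E *
    ((K1 * Normc.normc (Gamma (W1 m)) /
       Normc.normc (Gamma (w1 + z1 + (al * m%:R)%:C)))%:E *
     (K2 * Normc.normc (Gamma (W2 n)) /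
       Normc.normc (Gamma (w2 + z2 + (be * n%:R)%:C)))%:E))%E).
    apply: lee_wpmul2l; first by rewrite lee_fin normc_ge0.
    apply: lee_pmul; [| |exact: K1P|exact: K2P];
      by apply: integral_ge0 => t _; rewrite lee_fin normc_ge0.
  rewrite -!EFinM lee_fin /M /U /V.
  move: (G1 m) (G2 n); move: (Gamma (W1 m)) (Gamma (W2 n)).
  move: (Gamma (w1 + z1 + _)) (Gamma (w2 + z2 + _)) => B1 B2 A1 A2.
  rewrite -!normc_eq0 => A10 A20; rewrite !(Normc.normcM, Normc.normcV) !invfM.
  move: (Normc.normc B1)^-1 (Normc.normc B2)^-1 => e1 e2.
  rewrite le_eqVlt; apply/orP; left; apply/eqP.
  by field; rewrite A10 A20.
have MB N : sqsum M N <= K1 * K2 * B.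
  by rewrite /M sqsumZ ler_wpM2l// mulr_ge0// ltW.
have fB p : sq_bounded (fun m n => f m n p).
  rewrite (_ : (fun m n => _) = fun m n => beta2 w1 z1 w2 z2 p * u p m n); last first.
    by apply/funext => m; apply/funext => n.
  have [pD|pD] := boolP (p \in (`]0, 1[ `*` `]0, 1[ : set (R * R))).
    by apply: sq_boundedZ; exact: uB.
  exists 0 => N; rewrite /sqsum big1// => m _; rewrite big1// => n _.
  by rewrite beta2_eq0// mul0r Normc.normc0.
(* Off the unit square the kernel vanishes, and so does every term. *)
have SE p : beta2 w1 z1 w2 z2 p * dseries (u p) = dseries (fun m n => f m n p).
  rewrite (_ : (fun m n => f m n p) = fun m n => beta2 w1 z1 w2 z2 p * u p m n); last first.
    by apply/funext => m; apply/funext => n.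
  have [pD|pD] := boolP (p \in (`]0, 1[ `*` `]0, 1[ : set (R * R))).
    by rewrite dseriesZ//; exact: uB.
  rewrite beta2_eq0// mul0r -[LHS](mul0r (dseries (fun _ _ => 0))) -dseriesZ.
    by congr dseries; apply/funext => m; apply/funext => n; rewrite !mul0r.
  by exists 0 => N; rewrite /sqsum big1// => m _; rewrite big1// => n _;
    rewrite Normc.normc0.
have [iS eS] := @cintegral_dseries _ _ R (mu \x mu)%E f M _ mf fM MB fB.
rewrite (_ : (fun p => _) = (fun p => dseries (fun m n => f m n p))); last first.
  exact/funext.
split => //; rewrite eS -dseriesZ//; congr dseries.
apply/funext => m; apply/funext => n.
have e : cintegral (mu \x mu)%E setT (beta2 (W1 m) z1 (W2 n) z2) =
    cintegral mu setT (betaker (W1 m) z1) * cintegral mu setT (betaker (W2 n) z2).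
  by apply: cintegral_tensor; exact: cintegrable_betaker.
rewrite /f cintegralZ// e.
have q1 := Gamma_beta_quotient (W10 m) z10.
have q2 := Gamma_beta_quotient (W20 n) z20.
rewrite /U /V.
have -> : w1 + z1 + (al * m%:R)%:C = W1 m + z1 by rewrite addrAC.
have -> : w2 + z2 + (be * n%:R)%:C = W2 n + z2 by rewrite addrAC.
rewrite (invfM (Gamma (W1 m))) (invfM (Gamma (W1 m + z1))).
transitivity (c m n *
  (cintegral mu setT (betaker (W1 m) z1) / Gamma (W1 m)) *
  (cintegral mu setT (betaker (W2 n) z2) / Gamma (W2 n))); first by ring.
by rewrite q1 q2; ring.
Qed.

End beta_series.

Theorem mainTheorem5 (R : realType)
    (g1 g2 g3 d1 d2 d3 x y : R[i])
    (a1 a2 a3 a4 b1 b2 b3 b4 : R)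
    (s1 s2 : R[i])
    (a1_gt0 : 0 < a1) (a2_gt0 : 0 < a2) (a3_gt0 : 0 < a3) (a4_gt0 : 0 < a4)
    (b1_gt0 : 0 < b1) (b2_gt0 : 0 < b2) (b3_gt0 : 0 < b3) (b4_gt0 : 0 < b4)
    (s1_gt0 : 0 < complex.Re s1) (s2_gt0 : 0 < complex.Re s2)
    (* needed for the integral to converge at xi = 0 and eta = 0 *)
    (d2_gt0 : 0 < complex.Re d2) (d3_gt0 : 0 < complex.Re d3)
    (* the arguments of both functions are points of absolute convergence *)
    (lhs_cvg : forall xi eta : R, 0 < xi < 1 -> 0 < eta < 1 ->
       D1_abs_cvg g1 a1 b1 g2 a2 g3 b2 d1 a3 b3 d2 a4 d3 b4
         (x * (xi `^ a4)%:C) (y * (eta `^ b4)%:C))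
    (rhs_cvg :
       D1_abs_cvg g1 a1 b1 g2 a2 g3 b2 d1 a3 b3 (d2 + s1) a4 (d3 + s2) b4 x y) :
  let mu := @lebesgue_measure R in
  let F (xi eta : R) : R[i] :=
    cpowR xi (d2 - 1) * cpowR eta (d3 - 1)
    * cpowR (1 - xi) (s1 - 1) * cpowR (1 - eta) (s2 - 1)
    * D1 g1 a1 b1 g2 a2 g3 b2 d1 a3 b3 d2 a4 d3 b4
        (x * (xi `^ a4)%:C) (y * (eta `^ b4)%:C) in
  cintegrable (mu \x mu)%E (`]0, 1[ `*` `]0, 1[) (fun p => F p.1 p.2) /\
  cintegral mu `]0, 1[ (fun eta => cintegral mu `]0, 1[ (fun xi => F xi eta)) =
    Gamma s1 * Gamma s2 *
    D1 g1 a1 b1 g2 a2 g3 b2 d1 a3 b3 (d2 + s1) a4 (d3 + s2) b4 x y.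
Proof.
move=> mu F.
(* The part of the coefficients common to both series. *)
pose c m n := poch g1 (a1 * m%:R + b1 * n%:R) * poch g2 (a2 * m%:R) *
  poch g3 (b2 * n%:R) / Gamma (d1 + (a3 * m%:R + b3 * n%:R)%:C) *
  (x ^+ m * y ^+ n).
pose u (p : R * R) m n := c m n /
  (Gamma (d2 + (a4 * m%:R)%:C) * Gamma (d3 + (b4 * n%:R)%:C)) *
  ((p.1 `^ a4)%:C ^+ m * (p.2 `^ b4)%:C ^+ n).
pose V m n := c m n / (Gamma (d2 + s1 + (a4 * m%:R)%:C) *
  Gamma (d3 + s2 + (b4 * n%:R)%:C)).
have uE p : u p = D1_term g1 a1 b1 g2 a2 g3 b2 d1 a3 b3 d2 a4 d3 b4
    (x * (p.1 `^ a4)%:C) (y * (p.2 `^ b4)%:C).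
  apply/funext => m; apply/funext => n.
  rewrite /u /c /D1_term !exprMn.
  move: (poch g1 _) (poch g2 _) (poch g3 _) (Gamma (d1 + _)) (Gamma (d2 + _))
    (Gamma (d3 + _)) (x ^+ m) (y ^+ n) (_ ^+ m) (_ ^+ n) => *; rewrite invfM; ring.
have VE : V = D1_term g1 a1 b1 g2 a2 g3 b2 d1 a3 b3 (d2 + s1) a4 (d3 + s2) b4 x y.
  apply/funext => m; apply/funext => n.
  rewrite /V /c /D1_term.
  move: (poch g1 _) (poch g2 _) (poch g3 _) (Gamma (d1 + _))
    (Gamma (d2 + s1 + _)) (Gamma (d3 + s2 + _)) (x ^+ m) (y ^+ n) => *; rewrite invfM; ring.
have uB p : p \in (`]0, 1[ `*` `]0, 1[ : set (R * R)) -> sq_bounded (u p).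
  case: p => xi eta; rewrite inE /= !in_itv/= => -[hxi heta].
  apply: dseries_abs_cvg_bounded; rewrite uE; exact: lhs_cvg.
have VB : sq_bounded V by apply: dseries_abs_cvg_bounded; rewrite VE.
pose G p := beta2 d2 s1 d3 s2 p * dseries (u p).
have [iG eG] : cintegrable (mu \x mu)%E setT G /\
    cintegral (mu \x mu)%E setT G = Gamma s1 * Gamma s2 * dseries V.
  exact: (cintegral_beta2_dseries a4_gt0 b4_gt0 d2_gt0 s1_gt0 d3_gt0 s2_gt0 uB VB).
have GE p : G p = if p \in (`]0, 1[ `*` `]0, 1[ : set (R * R)) then F p.1 p.2 else 0.
  case: ifPn => pD; last by rewrite /G beta2_eq0// mul0r.
  move: pD; rewrite inE /= => -[h1 h2].
  rewrite /G /F /beta2 !betaker_indic h1 h2 uE -/(D1 _ _ _ _ _ _ _ _ _ _ _ _ _ _ _ _).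
  move: (D1 _ _ _ _ _ _ _ _ _ _ _ _ _ _ _ _) => S; ring.
have rhs : D1 g1 a1 b1 g2 a2 g3 b2 d1 a3 b3 (d2 + s1) a4 (d3 + s2) b4 x y =
    dseries V by rewrite VE.
split.
  apply: cintegrable_mkcond; first exact: measurableX.
  by rewrite (_ : (fun _ => _) = G)//; apply/funext => p; rewrite GE.
(* Both integrals over the unit interval extend by zero to the line. *)
transitivity (cintegral mu setT (fun eta => cintegral mu setT (fun xi => G (xi, eta)))); last first.
  by rewrite (cintegral21_prod iG) eG rhs.
rewrite cintegral_mkcond; apply: eq_cintegral => eta.
rewrite mem_setE; case: ifPn => heta.
  rewrite cintegral_mkcond; apply: eq_cintegral => xi.
  by rewrite GE in_setX /= !mem_setE heta andbT.
rewrite -[LHS](cintegral0 mu); apply: eq_cintegral => xi.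
by rewrite GE in_setX /= !mem_setE (negbTE heta) andbF.
Qed.
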